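(* Let $(X,L)$ be a measurable bundle of $C^*$-algebras over $\Omega$ (with the standing assumptions in the context), let $(L_0(\Omega,X),\widehat\varphi,\widehat T)$ be a $C^*$-dynamical system over $L_0$ and let $\{(X(\omega),\varphi_\omega,T_\omega):\omega\in\Omega\}$ be its measurable bundle of $C^*$-dynamical systems, i.e. $\widehat\varphi=\widehat{\varphi_\omega}$ and $\widehat T=\widehat{T_\omega}$. If $(X(\omega),\varphi_\omega,T_\omega)$ is uniquely ergodic for almost all $\omega\in\Omega$, then $(L_0(\Omega,X),\widehat\varphi,\widehat T)$ is uniquely ergodic.
   Context: $(\Omega,\Sigma,\lambda)$ is a measure space with finite complete measure $\lambda$; $M(\Omega)$ is the set of measurable complex functions on $\Omega$ (defined a.e.); $L_0=L_0(\Omega)$ is the algebra of a.e.-equivalence classes of measurable complex functions, with the a.e. order on real elements and unit $\mathbf 1$. A sequence $f_n$ in $L_0$ $(o)$-converges to $f$ if $|f_n-f|\le g_n$ for some sequence $g_n\downarrow0$ in $L_0$. $\mathcal L^\infty(\Omega)$ is the set of bounded measurable functions on $\Omega$ (defined everywhere, sup norm), and $L^\infty(\Omega)=\{f\in L_0:|f|\le\alpha\mathbf 1\text{ for some }\alpha>0\}$ with the usual norm. Measurable bundle of $C^*$-algebras: $X$ assigns to each $\omega\in\Omega$ a $C^*$-algebra $X(\omega)\ne\{0\}$. A section is a function $u$ defined a.e. on $\Omega$ with $u(\omega)\in X(\omega)$ on its domain. $(X,L)$, with $L$ a set of sections, is a measurable bundle of $C^*$-algebras if: $L$ is closed under complex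 linear combinations, products and involution (pointwise on intersections of domains); for each $c\in L$ the function $\omega\mapsto\|c(\omega)\|_{X(\omega)}$ is measurable; and for every $\omega$ the set $\{c(\omega):c\in L,\ \omega\in\mathrm{dom}(c)\}$ is dense in $X(\omega)$. A section $s$ is simple if $s(\omega)=\sum_{i=1}^n\chi_{A_i}(\omega)c_i(\omega)$ for a.e. $\omega$, $c_i\in L$, $A_i\in\Sigma$; a section is measurable if it is an a.e. pointwise norm limit of a sequence of simple sections. $M(\Omega,X)$ is the set of measurable sections; $L_0(\Omega,X)$ is its quotient by a.e. equality; $\widehat u$ is the class of $u$; $\|\widehat u\|\in L_0$ is the class of $\omega\mapsto\|u(\omega)\|_{X(\omega)}$. With pointwise operations $L_0(\Omega,X)$ is a $*$-algebra and an $L_0$-module (a $C^*$-algebra over $L_0$). A sequence $x_n$ in $L_0(\Omega,X)$ $(bo)$-converges to $x$ if $\|x_n-x\|$ $(o)$-converges to $0$ in $L_0$. $L^\infty(\Omega,X)=\{\widehat u:\|\widehat u\|\in L^\infty(\Omega)\}$, $\mathcal L^\infty(\Omega,X)=\{u\in M(\Omega,X):\|u(\cdot)\|_{X(\cdot)}\in\mathcal L^\infty(\Omega)\}$. Standing assumptions: there are a lifting $p$ and a vector-valued lifting $\ell$ associated with it, and $L_0(\Omega,X)$ has a unit $e$ with $\|e\|=\mathbf 1$; $e(\omega):=\ell(e)(\omega)$ is then the unit of $X(\omega)$. Here $p:L^\infty(\Omega)\to\mathcal L^\infty(\Omega)$ is a (unital) algebra homomorphism with $p(f)\in f$, $\mathrm{dom}\,p(f)=\Omega$,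 $\|p(f)\|_{\mathcal L^\infty(\Omega)}=\|f\|_{L^\infty(\Omega)}$, and $\ell:L^\infty(\Omega,X)\to\mathcal L^\infty(\Omega,X)$ satisfies $\ell(u)\in u$, $\mathrm{dom}\,\ell(u)=\Omega$, $\|\ell(u)(\omega)\|_{X(\omega)}=p(\|u\|)(\omega)$, $\ell(u+v)=\ell(u)+\ell(v)$, $\ell(fu)=p(f)\ell(u)$ for $f\in L^\infty(\Omega)$, $\ell(u^* )=\ell(u)^*$, $\ell(uv)=\ell(u)\ell(v)$, and $\{\ell(u)(\omega):u\in L^\infty(\Omega,X)\}$ is dense in $X(\omega)$ for every $\omega$. A state preserving $C^*$-dynamical system is a triple $(A,\varphi,T)$ of a unital $C^*$-algebra $A$, a state $\varphi$ on $A$, and a Markov operator (positive unital linear map) $T:A\to A$ with $\varphi\circ T=\varphi$. A collection of such systems $\{(X(\omega),\varphi_\omega,T_\omega):\omega\in\Omega\}$ is a measurable bundle of $C^*$-dynamical systems if $\omega\mapsto T_\omega u(\omega)$ is in $M(\Omega,X)$ and $\omega\mapsto\varphi_\omega(u(\omega))$ is in $M(\Omega)$ for every $u\in M(\Omega,X)$. Then $\widehat{\varphi_\omega}:L_0(\Omega,X)\to L_0$ sends $\widehat x$ to the class of $\omega\mapsto\varphi_\omega(x(\omega))$ and $\widehat{T_\omega}:L_0(\Omega,X)\to L_0(\Omega,X)$ sends $\widehat x$ to the class of $\omega\mapsto T_\omega x(\omega)$. A state preserving $C^*$-dynamical system over $L_0$ is a triple of a unital $C^*$-algebra over $L_0$,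 an $L_0$-state (positive $L_0$-linear $L_0$-valued functional $f$ with $\|f\|=\sup\{|f(x)|:\|x\|\le\mathbf 1\}=\mathbf 1$), and a Markov operator (positive $L_0$-linear, unit preserving), with the state invariant under the operator. A state preserving $C^*$-dynamical system $(A,\varphi,T)$ over $\mathbb C$ is uniquely ergodic if $\varphi$ is the only state $\psi$ on $A$ with $\psi\circ T=\psi$. A $C^*$-dynamical system $(\mathcal U,\varphi,T)$ over $L_0$ with unit $e$ is uniquely ergodic if $(bo)\text{-}\lim_n\frac1n\sum_{k=0}^{n-1}T^k(x)=\varphi(x)e$ for every $x\in\mathcal U$. *)

(* Defs.v *)
From HB Require Import structures.
From mathcomp Require Import all_boot all_order all_algebra generic_quotient.
From mathcomp Require Import all_classical all_reals all_analysis measurable_realfun.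
From mathcomp Require Import complex.

Set Implicit Arguments.
Unset Strict Implicit.
Unset Printing Implicit Defensive.

Import Order.TTheory GRing.Theory Num.Theory.
Import numFieldNormedType.Exports.

Local Open Scope classical_set_scope.
Local Open Scope complex_scope.
Local Open Scope ring_scope.

(* C*-algebras are not assumed to be unital, hence a product of their own;    *)
(* as always over [R[i]], the norm takes its values in (the reals of) [R[i]]. *)
HB.mixin Record isCStarAlgebra (R : realType) (A : Type)
    of CompleteNormedModule R[i] A := {
  cmul : A -> A -> A;
  star : A -> A;
  cmulA : associative cmul;
  cmulDl : left_distributive cmul +%R;
  cmulDr : right_distributive cmul +%R;
  cmulZl : forall (k : R[i]) (x y : A), cmul (k *: x) y = k *: cmul x y;
  cmulZr : forall (k : R[i]) (x y : A), cmul x (k *: y) = k *: cmul x y;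
  starK : involutive star;
  starD : {morph star : x y / x + y};
  starZ : forall (k : R[i]) (x : A), star (k *: x) = k^*%C *: star x;
  starM : forall x y : A, star (cmul x y) = cmul (star y) (star x);
  norm_cmul : forall x y : A, `|cmul x y| <= `|x| * `|y|;
  norm_cstar : forall x : A, `|cmul (star x) x| = `|x| ^+ 2 }.

#[short(type="cstarAlgType")]
HB.structure Definition CStarAlgebra (R : realType) :=
  { A of isCStarAlgebra R A & CompleteNormedModule R[i] A }.

Section dynamical_system.
Context (R : realType) (A : cstarAlgType R).

Definition is_unit (e : A) := forall x : A, cmul e x = x /\ cmul x e = x.

Definition cstar_pos (x : A) := exists y : A, x = cmul (star y) y.

Definition is_state (phi : {scalar A}) :=
  (forall x, cstar_pos x -> 0 <= phi x) /\
  supremums [set `|phi x| | x in [set x : A | `|x| <= 1]] 1.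

Definition is_markov (S : {linear A -> A}) :=
  (forall x, cstar_pos x -> cstar_pos (S x)) /\
  (forall e, is_unit e -> S e = e).

Definition is_dynsys (phi : {scalar A}) (S : {linear A -> A}) :=
  [/\ exists e, is_unit e, is_state phi, is_markov S
    & forall x, phi (S x) = phi x].

Definition uniquely_ergodic (phi : {scalar A}) (S : {linear A -> A}) :=
  forall psi : {scalar A}, is_state psi -> (forall x, psi (S x) = psi x) ->
    psi =1 phi.

End dynamical_system.

Section partial_sections.
Context (T : Type).

(* [u w = None] means that [w] is not in the domain of [u] *)
Definition psection (Y : T -> Type) := forall w, option (Y w).

Definition pdom (Y : T -> Type) (u : psection Y) : set T := [set w | u w].

Definition ptotal (Y : T -> Type) (u : forall w, Y w) : psection Y :=
  fun w => Some (u w).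

Definition pmap1 (Y Z : T -> Type) (op : forall w, Y w -> Z w)
  (u : psection Y) : psection Z := fun w => omap (op w) (u w).

Definition pmap2 (Y Z V : T -> Type) (op : forall w, Y w -> Z w -> V w)
    (u : psection Y) (v : psection Z) : psection V :=
  fun w => obind (fun x => omap (op w x) (v w)) (u w).

End partial_sections.

Record complete_measure d (T : measurableType d) (R : realType) := {
  cmeasure :> {finite_measure set T -> \bar R};
  cmeasure_complete : measure_is_complete cmeasure }.

Section ae_classes.
Context d (T : measurableType d) (R : realType).
Variable lambda : complete_measure T R.

Definition ae_defined (Y : T -> Type) (u : psection Y) :=
  \forall w \ae lambda, pdom u w.

Section quotient.
Variables (Y : T -> Type) (P : set (psection Y)).

Record aesection := AESection { aeval : psection Y; aevalP : P aeval }.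

HB.instance Definition _ := gen_eqMixin aesection.
HB.instance Definition _ := gen_choiceMixin aesection.

(* On a.e. defined sections this is a.e. equality of the values. *)
Definition ae_eqb (u v : aesection) := `[< \forall w \ae lambda, aeval u w = aeval v w >].

Let ae_eqb_refl : reflexive ae_eqb.
Proof. by move=> u; apply/asboolP/aeW. Qed.

Let ae_eqb_sym : symmetric ae_eqb.
Proof.
by move=> u v; apply/asboolP/asboolP; apply: filterS => w ->.
Qed.

Let ae_eqb_trans : transitive ae_eqb.
Proof.
move=> v u w /asboolP uv /asboolP vw; apply/asboolP.
by apply: filterS2 uv vw => x -> ->.
Qed.

Canonical ae_eqb_equiv := EquivRel ae_eqb ae_eqb_refl ae_eqb_sym ae_eqb_trans.

Local Open Scope quotient_scope.

Definition aeclass : Type := {eq_quot ae_eqb}.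
HB.instance Definition _ := Choice.on aeclass.
HB.instance Definition _ := EqQuotient.on aeclass.

Definition cls (u : aesection) : aeclass := \pi_aeclass u.

Definition in_cls (u : psection Y) (x : aeclass) :=
  \forall w \ae lambda, aeval (repr x) w = u w.

Lemma cls_eq (u v : aesection) :
  (\forall w \ae lambda, aeval u w = aeval v w) -> cls u = cls v.
Proof. by move=> uv; apply/eqmodP/asboolP. Qed.

Lemma cls_inj (u v : aesection) :
  cls u = cls v -> \forall w \ae lambda, aeval u w = aeval v w.
Proof. by move/eqmodP/asboolP. Qed.

Lemma in_cls_repr (u : aesection) : in_cls (aeval u) (cls u).
Proof. by apply: cls_inj; rewrite /cls reprK. Qed.

Lemma clsP (x : aeclass) : exists u, x = cls u.
Proof. by exists (repr x); rewrite /cls reprK. Qed.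

End quotient.

(* Fiberwise operations act on classes; [lift1E] and [lift2E] below show that *)
(* the choice of representatives is irrelevant.                               *)
Section lift.
Variables (Y Z V : T -> Type).
Variables (P : set (psection Y)) (Q : set (psection Z)) (S : set (psection V)).

Definition lift1 (op : forall w, Y w -> Z w)
    (H : forall u, P u -> Q (pmap1 op u)) (x : aeclass P) : aeclass Q :=
  cls (AESection (H _ (aevalP (repr x)))).

Definition lift2 (op : forall w, Y w -> Z w -> V w)
    (H : forall u v, P u -> Q v -> S (pmap2 op u v))
    (x : aeclass P) (y : aeclass Q) : aeclass S :=
  cls (AESection (H _ _ (aevalP (repr x)) (aevalP (repr y)))).

Lemma lift1E op H (u : aesection P) :
  @lift1 op H (cls u) = cls (AESection (H _ (aevalP u))).
Proof.
apply: cls_eq; apply: filterS (in_cls_repr u) => w /=.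
by rewrite /pmap1 => ->.
Qed.

Lemma lift2E op H (u : aesection P) (v : aesection Q) :
  @lift2 op H (cls u) (cls v) = cls (AESection (H _ _ (aevalP u) (aevalP v))).
Proof.
apply: cls_eq; apply: filterS2 (in_cls_repr u) (in_cls_repr v) => w /=.
by rewrite /pmap2 => -> ->.
Qed.

End lift.

End ae_classes.

Section L0.
Context d (T : measurableType d) (R : realType).
Variable lambda : complete_measure T R.

(* The domain of an a.e. defined function is measurable, since [lambda] is    *)
(* complete; the default value [0] is not used on this domain.                *)
Definition mfunction (f : psection (fun _ : T => R[i])) :=
  [/\ ae_defined lambda f,
      measurable_fun (pdom f) (fun w => complex.Re (odflt 0 (f w)))
    & measurable_fun (pdom f) (fun w => complex.Im (odflt 0 (f w)))].

Lemma pdom_measurable (Y : T -> Type) (u : psection Y) :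
  ae_defined lambda u -> measurable (pdom u).
Proof.
move=> du; rewrite -(setCK (pdom u)); apply: measurableC.
exact: (@cmeasure_complete _ _ _ lambda).
Qed.

Lemma ae_measurable_real (f g : T -> R) :
  (\forall w \ae lambda, f w = g w) ->
  measurable_fun setT f -> measurable_fun setT g.
Proof.
move=> fg /measurable_EFinP mf; apply/measurable_EFinP.
apply: (ae_measurable_fun (@cmeasure_complete _ _ _ lambda)) mf.
by apply: filterS fg => w /= -> _.
Qed.

Lemma mfunctionP (f : psection (fun _ : T => R[i])) :
  mfunction f <-> exists g : T -> R[i],
    [/\ measurable_fun setT (fun w => complex.Re (g w)),
        measurable_fun setT (fun w => complex.Im (g w))
      & \forall w \ae lambda, f w = Some (g w)].
Proof.
split=> [[df mRe mIm]|[g [mRe mIm fg]]].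
  exists (fun w => odflt 0 (f w)); split.
  - move/(measurable_restrictT _ (pdom_measurable df)): mRe.
    congr measurable_fun; apply/funext => w; rewrite patchE /pdom.
    case: ifPn => //; rewrite notin_setE /=.
    by case: (f w) => // /(_ isT).
  - move/(measurable_restrictT _ (pdom_measurable df)): mIm.
    congr measurable_fun; apply/funext => w; rewrite patchE /pdom.
    case: ifPn => //; rewrite notin_setE /=.
    by case: (f w) => // /(_ isT).
  - by apply: filterS df => w; rewrite /pdom /=; case: (f w).
split.
- by apply: filterS fg => w; rewrite /pdom /= => ->.
- apply: measurable_funTS; apply: ae_measurable_real mRe.
  by apply: filterS fg => w ->.
- apply: measurable_funTS; apply: ae_measurable_real mIm.
  by apply: filterS fg => w ->.
Qed.

Lemma mfunction_ptotal (g : T -> R[i]) :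
  measurable_fun setT (fun w => complex.Re (g w)) ->
  measurable_fun setT (fun w => complex.Im (g w)) ->
  mfunction (ptotal g).
Proof. by move=> mRe mIm; apply/mfunctionP; exists g; split=> //; exact: aeW. Qed.

Lemma mfunction_cst (c : R[i]) : mfunction (ptotal (fun=> c)).
Proof. by apply: mfunction_ptotal => /=; exact: measurable_cst. Qed.

Lemma mfunction_opp f : mfunction f -> mfunction (pmap1 (fun=> -%R) f).
Proof.
move=> /mfunctionP[g [mRe mIm fg]]; apply/mfunctionP; exists (fun w => - g w).
split; last by apply: filterS fg => w; rewrite /pmap1 => ->.
- rewrite (_ : (fun w => _) = (fun w => - complex.Re (g w))).
    exact: measurable_funN.
  by apply/funext => w; case: (g w).
- rewrite (_ : (fun w => _) = (fun w => - complex.Im (g w))).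
    exact: measurable_funN.
  by apply/funext => w; case: (g w).
Qed.

Lemma mfunction_add f g :
  mfunction f -> mfunction g -> mfunction (pmap2 (fun=> +%R) f g).
Proof.
move=> /mfunctionP[f' [mRe mIm ff]] /mfunctionP[g' [mRe' mIm' gg]].
apply/mfunctionP; exists (fun w => f' w + g' w).
split; last by apply: filterS2 ff gg => w; rewrite /pmap2 => -> ->.
- rewrite (_ : (fun w => _) = (fun w => complex.Re (f' w) + complex.Re (g' w))).
    exact: measurable_funD.
  by apply/funext => w; case: (f' w); case: (g' w).
- rewrite (_ : (fun w => _) = (fun w => complex.Im (f' w) + complex.Im (g' w))).
    exact: measurable_funD.
  by apply/funext => w; case: (f' w); case: (g' w).
Qed.

Lemma mfunction_mul f g :
  mfunction f -> mfunction g -> mfunction (pmap2 (fun=> *%R) f g).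
Proof.
move=> /mfunctionP[f' [mRe mIm ff]] /mfunctionP[g' [mRe' mIm' gg]].
apply/mfunctionP; exists (fun w => f' w * g' w).
split; last by apply: filterS2 ff gg => w; rewrite /pmap2 => -> ->.
- rewrite (_ : (fun w => _) = (fun w => complex.Re (f' w) * complex.Re (g' w)
                                     - complex.Im (f' w) * complex.Im (g' w))).
    by apply: measurable_funB; exact: measurable_funM.
  by apply/funext => w; case: (f' w); case: (g' w).
- rewrite (_ : (fun w => _) = (fun w => complex.Re (f' w) * complex.Im (g' w)
                                     + complex.Im (f' w) * complex.Re (g' w))).
    by apply: measurable_funD; exact: measurable_funM.
  by apply/funext => w; case: (f' w); case: (g' w).
Qed.

Lemma mfunction_norm f :
  mfunction f -> mfunction (pmap1 (fun=> @Num.norm _ R[i]) f).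
Proof.
move=> /mfunctionP[g [mRe mIm fg]]; apply/mfunctionP; exists (fun w => `|g w|).
split; last by apply: filterS fg => w; rewrite /pmap1 => ->.
- rewrite (_ : (fun w => _) = (fun w =>
      Num.sqrt (complex.Re (g w) ^+ 2 + complex.Im (g w) ^+ 2))); last first.
    by apply/funext => w; rewrite normc_def.
  apply: measurableT_comp.
    by apply: continuous_measurable_fun; exact: sqrt_continuous.
  by apply: measurable_funD; exact: measurable_funX.
- by rewrite (_ : (fun w => _) = (fun=> 0)).
Qed.

Definition L0 : Type := aeclass lambda mfunction.
HB.instance Definition _ := Choice.on L0.

Definition L0_cst (c : R[i]) : L0 := cls lambda (AESection (mfunction_cst c)).

Definition L0_opp : L0 -> L0 := lift1 mfunction_opp.
Definition L0_add : L0 -> L0 -> L0 := lift2 mfunction_add.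
Definition L0_mul : L0 -> L0 -> L0 := lift2 mfunction_mul.
Definition L0_abs : L0 -> L0 := lift1 mfunction_norm.

Lemma L0_addA : associative L0_add.
Proof.
move=> x y z; case: (clsP x) (clsP y) (clsP z) => u -> [v ->] [w ->].
rewrite /L0_add !lift2E; apply: cls_eq; apply: aeW => t /=; rewrite /pmap2.
by case: (aeval u t) (aeval v t) (aeval w t) => [a|] [b|] [c|]//=; rewrite addrA.
Qed.

Lemma L0_addC : commutative L0_add.
Proof.
move=> x y; case: (clsP x) (clsP y) => u -> [v ->].
rewrite /L0_add !lift2E; apply: cls_eq; apply: aeW => t /=; rewrite /pmap2.
by case: (aeval u t) (aeval v t) => [a|] [b|]//=; rewrite addrC.
Qed.

Lemma L0_add0 : left_id (L0_cst 0) L0_add.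
Proof.
move=> x; case: (clsP x) => u ->.
rewrite /L0_add /L0_cst !lift2E; apply: cls_eq; apply: aeW => t /=.
by rewrite /pmap2; case: (aeval u t) => [a|]//=; rewrite add0r.
Qed.

Lemma L0_addN : left_inverse (L0_cst 0) L0_opp L0_add.
Proof.
move=> x; case: (clsP x) => u ->.
rewrite /L0_add /L0_opp /L0_cst lift1E !lift2E; apply: cls_eq.
have [du _ _] := aevalP u; apply: filterS du => t.
by rewrite /pdom/= /pmap1 /pmap2; case: (aeval u t) => [a|]//= _; rewrite addNr.
Qed.

HB.instance Definition _ :=
  GRing.isZmodule.Build L0 L0_addA L0_addC L0_add0 L0_addN.

Lemma L0_mulA : associative L0_mul.
Proof.
move=> x y z; case: (clsP x) (clsP y) (clsP z) => u -> [v ->] [w ->].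
rewrite /L0_mul !lift2E; apply: cls_eq; apply: aeW => t /=; rewrite /pmap2.
by case: (aeval u t) (aeval v t) (aeval w t) => [a|] [b|] [c|]//=; rewrite mulrA.
Qed.

Lemma L0_mulC : commutative L0_mul.
Proof.
move=> x y; case: (clsP x) (clsP y) => u -> [v ->].
rewrite /L0_mul !lift2E; apply: cls_eq; apply: aeW => t /=; rewrite /pmap2.
by case: (aeval u t) (aeval v t) => [a|] [b|]//=; rewrite mulrC.
Qed.

Lemma L0_mul1 : left_id (L0_cst 1) L0_mul.
Proof.
move=> x; case: (clsP x) => u ->.
rewrite /L0_mul /L0_cst !lift2E; apply: cls_eq; apply: aeW => t /=.
by rewrite /pmap2; case: (aeval u t) => [a|]//=; rewrite mul1r.
Qed.

Lemma L0_mulDl : left_distributive L0_mul +%R.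
Proof.
move=> x y z; case: (clsP x) (clsP y) (clsP z) => u -> [v ->] [w ->].
rewrite /L0_mul -!/(L0_add _ _) /+%R/= /L0_add !lift2E; apply: cls_eq.
apply: aeW => t /=; rewrite /pmap2.
by case: (aeval u t) (aeval v t) (aeval w t) => [a|] [b|] [c|]//=; rewrite mulrDl.
Qed.

HB.instance Definition _ :=
  GRing.Zmodule_isComPzRing.Build L0 L0_mulA L0_mulC L0_mul1 L0_mulDl.

(* a.e. order; on non-real values, [<=] also compares the imaginary parts     *)
(* for equality, so that an element comparable to a real one is real.         *)
Definition L0_le (x y : L0) : bool := `[< \forall w \ae lambda,
  exists a b : R[i],
    [/\ aeval (repr x) w = Some a, aeval (repr y) w = Some b & a <= b] >].

Lemma L0_le_refl : reflexive L0_le.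
Proof.
move=> x; apply/asboolP; have [dx _ _] := aevalP (repr x).
apply: filterS dx => w; rewrite /pdom/=.
by case: (aeval (repr x) w) => // a _; exists a, a.
Qed.

Lemma L0_le_anti : antisymmetric L0_le.
Proof.
move=> x y /andP[/asboolP xy /asboolP yx].
rewrite -(reprK x) -(reprK y); apply: cls_eq.
apply: filterS2 xy yx => w [a [b [-> -> ab]]] [c [e [[<-] [<-] ba]]].
by congr Some; apply/eqP; rewrite eq_le ab ba.
Qed.

Lemma L0_le_trans : transitive L0_le.
Proof.
move=> y x z /asboolP xy /asboolP yz; apply/asboolP.
apply: filterS2 xy yz => w [a [b [-> -> ab]]] [c [e [[<-] -> ba]]].
by exists a, e; split=> //; exact: le_trans ba.
Qed.

HB.instance Definition _ := Order.Le_isPOrder.Build ring_display L0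
  L0_le_refl L0_le_anti L0_le_trans.

Definition o_cvg (f : nat -> L0) (l : L0) := exists g : nat -> L0,
  [/\ forall n, g n.+1 <= g n, infimums (range g) 0
    & forall n, L0_abs (f n - l) <= g n].

Definition Linf : set L0 :=
  [set f | exists2 a : R, 0 < a & L0_abs f <= L0_cst a%:C].

Definition Linf_norm (f : L0) : R :=
  inf [set a : R | 0 <= a /\ L0_abs f <= L0_cst a%:C].

Definition calLinf : set (T -> R[i]) :=
  [set g | mfunction (ptotal g) /\ exists a : R, forall w, `|g w| <= a%:C].

Definition calLinf_norm (g : T -> R[i]) : R :=
  sup [set complex.Re `|g w| | w in setT].

(* Only the values of [p] on [Linf] are relevant. *)
Record is_lifting (p : L0 -> T -> R[i]) : Prop := {
  lifting_calLinf : forall f, Linf f -> calLinf (p f);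
  lifting_in_cls : forall f, Linf f -> in_cls (ptotal (p f)) f;
  lifting_norm : forall f, Linf f -> calLinf_norm (p f) = Linf_norm f;
  lifting1 : forall w, p 1 w = 1;
  liftingD : forall f g, Linf f -> Linf g ->
    forall w, p (f + g) w = p f w + p g w;
  liftingZ : forall (c : R[i]) f, Linf f ->
    forall w, p (L0_cst c * f) w = c * p f w;
  liftingM : forall f g, Linf f -> Linf g ->
    forall w, p (f * g) w = p f w * p g w }.

End L0.

Section cstar_lemmas.
Context (R : realType) (A : cstarAlgType R).

Lemma cmul0x (x : A) : cmul 0 x = 0.
Proof. by rewrite -(scale0r 0) cmulZl !scale0r. Qed.

Lemma cmulx0 (x : A) : cmul x 0 = 0.
Proof. by rewrite -(scale0r 0) cmulZr !scale0r. Qed.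

Lemma cmulBl (x y z : A) : cmul (x - y) z = cmul x z - cmul y z.
Proof. by rewrite cmulDl -scaleN1r cmulZl scaleN1r. Qed.

Lemma cmulBr (x y z : A) : cmul x (y - z) = cmul x y - cmul x z.
Proof. by rewrite cmulDr -scaleN1r cmulZr scaleN1r. Qed.

Lemma star0 : star (0 : A) = 0.
Proof. by apply: (addrI (star 0)); rewrite -starD !addr0. Qed.

Lemma starB (x y : A) : star (x - y) = star x - star y.
Proof. by apply: (addIr (star y)); rewrite -starD !subrK. Qed.

Lemma norm_star (x : A) : `|star x| = `|x|.
Proof.
have le y : `|y : A| <= `|star y|.
  have [->|y0] := eqVneq y 0; first by rewrite normr0 normr_ge0.
  have yp : 0 < `|y| by rewrite normr_gt0.
  by rewrite -(ler_pM2r yp) -expr2 -norm_cstar norm_cmul.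
by apply/eqP; rewrite eq_le le -{2}(starK x) le.
Qed.

Lemma cmul_suml (I : finType) (F : I -> A) (x : A) :
  cmul (\sum_i F i) x = \sum_i cmul (F i) x.
Proof.
by apply: (big_morph (fun y => cmul y x)) => [y z|];
  rewrite ?cmulDl ?cmul0x.
Qed.

Lemma cmul_sumr (I : finType) (F : I -> A) (x : A) :
  cmul x (\sum_i F i) = \sum_i cmul x (F i).
Proof. by apply: (big_morph (cmul x)) => [y z|]; rewrite ?cmulDr ?cmulx0. Qed.

Lemma star_sum (I : finType) (F : I -> A) :
  star (\sum_i F i) = \sum_i star (F i).
Proof. by apply: (big_morph star) => [y z|]; rewrite ?starD ?star0. Qed.

Lemma cvg_cmul (u v : nat -> A) (x y : A) :
  u @ \oo --> x -> v @ \oo --> y -> (fun n => cmul (u n) (v n)) @ \oo --> cmul x y.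
Proof.
move=> /cvgrPdist_lt ux /cvgrPdist_lt vy; apply/cvgrPdist_lt => e e0.
pose c : R[i] := `|x| + `|y| + 1.
have c0 : 0 < c by rewrite ltr_wpDl// addr_ge0.
pose e1 := Num.min 1 (e / 2 / c).
have e2 : 0 < e / 2 / c by rewrite !divr_gt0.
near=> n.
have un : `|x - u n| < e / 2 / c by near: n; exact: ux.
have vn : `|y - v n| < e / 2 / c by near: n; exact: vy.
have vn1 : `|y - v n| < 1 by near: n; exact: vy.
rewrite (_ : _ - _ = cmul x (y - v n) + cmul (x - u n) (v n)); last first.
  by rewrite cmulBr cmulBl addrA subrK.
rewrite (le_lt_trans (ler_normD _ _))// [ltRHS](splitr e) ltr_leD//.
- rewrite (le_lt_trans (norm_cmul _ _))//.
  apply: (@le_lt_trans _ _ (c * `|y - v n|)).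
    by rewrite ler_wpM2r// /c -addrA lerDl addr_ge0.
  by rewrite mulrC -ltr_pdivlMr.
- rewrite (le_trans (norm_cmul _ _))//.
  apply: (@le_trans _ _ (`|x - u n| * c)); last first.
    by rewrite -ler_pdivlMr// ltW.
  rewrite ler_wpM2l// /c -addrA ler_wpDl//.
  rewrite -{1}[v n](subKr y) (le_trans (ler_normB _ _))//.
  by rewrite lerD2l ltW.
Unshelve. all: by end_near. Qed.

Lemma cvg_star (u : nat -> A) (x : A) :
  u @ \oo --> x -> (fun n => star (u n)) @ \oo --> star x.
Proof.
move=> /cvgrPdist_lt ux; apply/cvgrPdist_lt => e e0.
near=> n; rewrite -starB norm_star; near: n; exact: ux.
Unshelve. all: by end_near. Qed.

Lemma cvg_realZ (f : nat -> R) (a : R) (u : nat -> A) (x : A) :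
  f @ \oo --> a -> u @ \oo --> x ->
  (fun n => (f n)%:C *: u n) @ \oo --> a%:C *: x.
Proof.
move=> fa ux; apply: cvgZ ux.
apply/(@cvgrPdist_lt _ (R[i] : numFieldType)) => e e0.
have er : e = (complex.Re e)%:C by rewrite RRe_real// gtr0_real.
move: e0; rewrite er ltcR => e0.
move/cvgrPdist_lt : fa => /(_ _ e0); apply: filterS => n.
rewrite -ltcR; congr (_ < _).
by rewrite -rmorphB/= normc_def/= expr0n/= addr0 sqrtr_sqr.
Qed.

Lemma cvg_normRe (u : nat -> A) (x : A) : u @ \oo --> x ->
  (fun n => complex.Re `|u n|) @ \oo --> complex.Re `|x|.
Proof.
move=> /cvgrPdist_lt ux; apply/cvgrPdist_lt => e e0.
have := ux e%:C; rewrite ltcR => /(_ e0); apply: filterS => n une.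
rewrite -ltcR; apply: le_lt_trans une.
apply: le_trans (ler_dist_dist x (u n)).
have -> : complex.Re `|x| - complex.Re `|u n| = complex.Re (`|x| - `|u n|).
  by rewrite raddfB.
exact: normc_ge_Re.
Qed.

End cstar_lemmas.

Record cstar_bundle d (T : measurableType d) (R : realType)
    (lambda : complete_measure T R) := {
  fiber :> T -> cstarAlgType R;
  fiber_neq0 : forall w, exists x : fiber w, x != 0;
  bsec : set (psection fiber);
  bsec_defined : forall c, bsec c -> ae_defined lambda c;
  bsec_lin : forall (a b : R[i]) c c', bsec c -> bsec c' ->
    bsec (pmap2 (fun w (x y : fiber w) => a *: x + b *: y) c c');
  bsec_mul : forall c c', bsec c -> bsec c' ->
    bsec (pmap2 (fun w => @cmul R (fiber w)) c c');
  bsec_star : forall c, bsec c -> bsec (pmap1 (fun w => @star R (fiber w)) c);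
  bsec_norm : forall c, bsec c ->
    mfunction lambda (pmap1 (fun w (x : fiber w) => `|x|) c);
  bsec_dense : forall w, dense [set x | exists2 c, bsec c & c w = Some x] }.

Section approximation.
Import HBSimple.

Lemma simple_approximation d (T : measurableType d) (R : realType) (g : T -> R) :
  measurable_fun setT g -> exists2 h : nat -> T -> R,
    forall n, exists (m : nat) (r : 'I_m -> R) (B : 'I_m -> set T),
      (forall i, measurable (B i)) /\
      (forall w, h n w = \sum_(i < m) r i * \1_(B i) w)
    & forall w, h ^~ w @ \oo --> g w.
Proof.
move=> mg.
have [h hg] := approximation_sfun measurableT ((measurable_EFinP _ _).2 mg).
exists (fun n => h n) => [n|w]; last by have /fine_cvgP[_] := hg w I.
pose r := finmap.enum_fset (fset_set (range (h n))).
exists (size r), (fun i => r`_i), (fun i => h n @^-1` [set r`_i]).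
by split=> [i|w]; [exact: measurable_sfunP|rewrite fimfunEord].
Qed.

End approximation.

Section L0X.
Context d (T : measurableType d) (R : realType).
Context (lambda : complete_measure T R) (X : cstar_bundle lambda).

Definition simple_section (s : psection (fiber X)) :=
  exists (n : nat) (A : 'I_n -> set T) (c : 'I_n -> psection (fiber X)),
    [/\ forall i, measurable (A i), forall i, bsec (c i)
      & \forall w \ae lambda, exists y : 'I_n -> X w,
          (forall i, c i w = Some (y i)) /\
          s w = Some (\sum_(i < n) (\1_(A i) w : R)%:C *: y i)].

Definition msection (u : psection (fiber X)) :=
  exists2 s : nat -> psection (fiber X), forall n, simple_section (s n)
    & \forall w \ae lambda, exists (y : nat -> X w) (x : X w),
        [/\ forall n, s n w = Some (y n), u w = Some x & y @ \oo --> x].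

Lemma simple_fin (I : finType) (A : I -> set T) (c : I -> psection (fiber X))
    (s : psection (fiber X)) :
  (forall i, measurable (A i)) -> (forall i, bsec (c i)) ->
  (\forall w \ae lambda, exists y : I -> X w, (forall i, c i w = Some (y i)) /\
     s w = Some (\sum_i (\1_(A i) w : R)%:C *: y i)) ->
  simple_section s.
Proof.
move=> mA bc sE; exists #|I|, (A \o enum_val), (c \o enum_val).
split=> [i|i|]; rewrite /=; [exact: mA|exact: bc|].
apply: filterS sE => w [y [cy ->]]; exists (y \o enum_val); split=> [i|].
  exact: cy.
by congr Some; rewrite (reindex_onto enum_val enum_rank) => [|i _];
  rewrite ?enum_rankK//; apply: eq_bigl => i; rewrite enum_valK eqxx.
Qed.

Lemma msection_defined u : msection u -> ae_defined lambda u.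
Proof. by case=> s _; apply: filterS => w [y [x [_ + _]]]; rewrite /pdom/= => ->. Qed.

Lemma msection0 : msection (ptotal (fun w => 0 : X w)).
Proof.
exists (fun=> ptotal (fun w => 0)).
  move=> _; exists 0, (fun=> set0), (fun=> ptotal (fun w => 0)); split=> [[]//|[]//|].
  by apply: aeW => w; exists (fun=> 0); split=> [[]//|]; rewrite big_ord0.
by apply: aeW => w; exists (fun=> 0), 0; split=> //; exact: cvg_cst.
Qed.

Lemma msection_add u v : msection u -> msection v ->
  msection (pmap2 (fun w => @GRing.add (X w)) u v).
Proof.
case=> [s ss su] [t st tv].
exists (fun n => pmap2 (fun w => @GRing.add (X w)) (s n) (t n)).
  move=> n; have [m [A [c [mA bc sE]]]] := ss n.
  have [m' [B [c' [mB bc' tE]]]] := st n.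
  apply: (@simple_fin ('I_m + 'I_m')%type
    (fun k => match k with inl i => A i | inr j => B j end)
    (fun k => match k with inl i => c i | inr j => c' j end)) => [[]//|[]//|].
  apply: filterS2 sE tE => w [y [cy sE]] [z [cz tE]].
  exists (fun k => match k with inl i => y i | inr j => z j end).
  by split=> [[]//|]; rewrite big_sumType/= /pmap2 sE tE.
apply: filterS2 su tv => w [y [x [sy ux yx]]] [y' [x' [ty vx yx']]].
exists (fun n => y n + y' n), (x + x'); split=> [n||].
- by rewrite /pmap2 sy ty.
- by rewrite /pmap2 ux vx.
- exact: cvgD.
Qed.

Lemma msection_mul u v : msection u -> msection v ->
  msection (pmap2 (fun w => @cmul R (X w)) u v).
Proof.
case=> [s ss su] [t st tv].
exists (fun n => pmap2 (fun w => @cmul R (X w)) (s n) (t n)).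
  move=> n; have [m [A [c [mA bc sE]]]] := ss n.
  have [m' [B [c' [mB bc' tE]]]] := st n.
  apply: (@simple_fin ('I_m * 'I_m')%type (fun k => A k.1 `&` B k.2)
    (fun k => pmap2 (fun w => @cmul R (X w)) (c k.1) (c' k.2))) => [k|k|].
  - exact: measurableI.
  - exact: bsec_mul.
  apply: filterS2 sE tE => w [y [cy sE]] [z [cz tE]].
  exists (fun k => cmul (y k.1) (z k.2)).
  split=> [k|]; first by rewrite /pmap2 cy cz.
  rewrite /pmap2 sE tE /=; congr Some.
  rewrite cmul_suml -(pair_bigA _ (fun i j =>
    (\1_(A i `&` B j) w : R)%:C *: cmul (y i) (z j)))/=.
  apply: eq_bigr => i _; rewrite cmul_sumr; apply: eq_bigr => j _.
  by rewrite cmulZl cmulZr scalerA -rmorphM/= indicI.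
apply: filterS2 su tv => w [y [x [sy ux yx]]] [y' [x' [ty vx yx']]].
exists (fun n => cmul (y n) (y' n)), (cmul x x'); split=> [n||].
- by rewrite /pmap2 sy ty.
- by rewrite /pmap2 ux vx.
- exact: cvg_cmul.
Qed.

Lemma msection_star u : msection u ->
  msection (pmap1 (fun w => @star R (X w)) u).
Proof.
case=> [s ss su].
exists (fun n => pmap1 (fun w => @star R (X w)) (s n)).
  move=> n; have [m [A [c [mA bc sE]]]] := ss n.
  exists m, A, (fun i => pmap1 (fun w => @star R (X w)) (c i)).
  split=> [i|i|]; [exact: mA|exact: bsec_star|].
  apply: filterS sE => w [y [cy sE]]; exists (fun i => star (y i)).
  split=> [i|]; first by rewrite /pmap1 cy.
  rewrite /pmap1 sE /= star_sum; congr Some; apply: eq_bigr => i _.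
  by rewrite starZ conjc_real.
apply: filterS su => w [y [x [sy ux yx]]].
exists (fun n => star (y n)), (star x); split=> [n||].
- by rewrite /pmap1 sy.
- by rewrite /pmap1 ux.
- exact: cvg_star.
Qed.

Lemma bsec_scale (a : R[i]) c : bsec c ->
  bsec (pmap1 (fun w => @GRing.scale _ (X w) a) c).
Proof.
move=> bc; have := bsec_lin a 0 bc bc; congr bsec; apply: functional_extensionality_dep => w.
by rewrite /pmap1 /pmap2; case: (c w) => //= x; rewrite scale0r addr0.
Qed.

Lemma msection_scalec (a : R[i]) u : msection u ->
  msection (pmap1 (fun w => @GRing.scale _ (X w) a) u).
Proof.
case=> [s ss su].
exists (fun n => pmap1 (fun w => @GRing.scale _ (X w) a) (s n)).
  move=> n; have [m [A [c [mA bc sE]]]] := ss n.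
  exists m, A, (fun i => pmap1 (fun w => @GRing.scale _ (X w) a) (c i)).
  split=> [i|i|]; [exact: mA|exact: bsec_scale|].
  apply: filterS sE => w [y [cy sE]]; exists (fun i => a *: y i).
  split=> [i|]; first by rewrite /pmap1 cy.
  rewrite /pmap1 sE /= scaler_sumr; congr Some; apply: eq_bigr => i _.
  by rewrite !scalerA mulrC.
apply: filterS su => w [y [x [sy ux yx]]].
exists (fun n => a *: y n), (a *: x); split=> [n||].
- by rewrite /pmap1 sy.
- by rewrite /pmap1 ux.
- by apply: cvgZ yx; exact: cvg_cst.
Qed.

Lemma msection_opp u : msection u ->
  msection (pmap1 (fun w => @GRing.opp (X w)) u).
Proof.
move=> /(msection_scalec (-1)); congr msection.
apply: functional_extensionality_dep => w; rewrite /pmap1.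
by case: (u w) => //= x; rewrite scaleN1r.
Qed.

Lemma msection_realZ (g : T -> R) u : measurable_fun setT g -> msection u ->
  msection (pmap2 (fun w (a : R) (x : X w) => a%:C *: x) (ptotal g) u).
Proof.
move=> mg [s ss su].
have [h hE hg] := simple_approximation mg.
exists (fun n => pmap2 (fun w (a : R) (x : X w) => a%:C *: x)
                       (ptotal (h n)) (s n)).
  move=> n; have [m [A [c [mA bc sE]]]] := ss n.
  have [m' [r [B [mB {}hE]]]] := hE n.
  apply: (@simple_fin ('I_m' * 'I_m)%type (fun k => B k.1 `&` A k.2)
    (fun k => pmap1 (fun w => @GRing.scale _ (X w) (r k.1)%:C) (c k.2)))
    => [k|k|].
  - exact: measurableI.
  - exact: bsec_scale.
  apply: filterS sE => w [y [cy sE]]; exists (fun k => (r k.1)%:C *: y k.2).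
  split=> [k|]; first by rewrite /pmap1 cy.
  rewrite /pmap2 /ptotal sE /=; congr Some.
  rewrite hE rmorph_sum scaler_suml.
  rewrite -(pair_bigA _ (fun i j =>
    (\1_(B i `&` A j) w : R)%:C *: ((r i)%:C *: y j)))/=.
  apply: eq_bigr => i _; rewrite scaler_sumr; apply: eq_bigr => j _.
  rewrite !scalerA -!rmorphM/= indicI/=; congr (_%:C *: _).
  by rewrite -mulrA mulrC.
apply: filterS su => w [y [x [sy ux yx]]].
exists (fun n => (h n w)%:C *: y n), ((g w)%:C *: x); split=> [n||].
- by rewrite /pmap2 /ptotal sy.
- by rewrite /pmap2 /ptotal ux.
- exact: cvg_realZ (hg w) yx.
Qed.

Lemma msection_ae u v : (\forall w \ae lambda, u w = v w) -> msection u ->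
  msection v.
Proof.
by move=> uv [s ss su]; exists s => //; apply: filterS2 uv su => w ->.
Qed.

Lemma msection_scale f u : mfunction lambda f -> msection u ->
  msection (pmap2 (fun w => @GRing.scale _ (X w)) f u).
Proof.
move=> /mfunctionP[g [mRe mIm fg]] mu.
have := msection_add (msection_realZ mRe mu)
  (msection_scalec 'i (msection_realZ mIm mu)).
apply: msection_ae; apply: filterS2 fg (msection_defined mu) => w.
rewrite /pdom/= /pmap1 /pmap2 /ptotal => ->; case: (u w) => //= x _.
by rewrite scalerA -scalerDl [in RHS](complexE (g w)).
Qed.

Lemma bsec_ex : exists c : psection (fiber X), bsec c.
Proof.
have [|x [_ [c bc _]]] := @bsec_dense _ _ _ _ X point setT _ openT.
  by exists 0.
by exists c.
Qed.

Lemma simple_norm (n : nat) (A : 'I_n -> set T) (c : 'I_n -> psection (fiber X)) c0 :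
    (forall i, measurable (A i)) -> (forall i, bsec (c i)) -> bsec c0 ->
  exists2 g : T -> R, measurable_fun setT g & \forall w \ae lambda,
    exists (x : X w) (y : 'I_n -> X w), [/\ c0 w = Some x,
      forall i, c i w = Some (y i) &
      g w = complex.Re `|x + \sum_(i < n) (\1_(A i) w : R)%:C *: y i|].
Proof.
elim: n A c c0 => [|n IH] A c c0 mA bc bc0.
  have /mfunctionP[g [mRe _ gE]] := bsec_norm bc0.
  exists (fun w => complex.Re (g w)) => //.
  apply: filterS gE => w; rewrite /pmap1; case: (c0 w) => //= x [xg].
  exists x, (fun=> 0); split=> //; first by case.
  by rewrite big_ord0 addr0 xg.
have [||g1 mg1 g1E] := IH (A \o lift ord0) (c \o lift ord0) c0 _ _ bc0.
- by move=> i; exact: mA.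
- by move=> i; exact: bc.
have [||g2 mg2 g2E] := IH (A \o lift ord0) (c \o lift ord0) _ _ _
  (bsec_lin 1 1 bc0 (bc ord0)).
- by move=> i; exact: mA.
- by move=> i; exact: bc.
exists (fun w => \1_(A ord0) w * g2 w + \1_(~` A ord0) w * g1 w).
  apply: measurable_funD; apply: measurable_funM => //;
    by apply: measurable_indic => //; exact: measurableC.
apply: filterS2 g1E g2E => w [x [y [c0x cy ->]]] [x' [y' [cx' cy' ->]]].
move: cx'; rewrite /pmap2 c0x /=.
case E : (c ord0 w) => [z|] //= [<-].
have -> : y' = y.
  by apply/funext => i; have := cy' i; rewrite cy => -[].
exists x, (fun i => if unlift ord0 i is Some j then y j else z); split=> //.
  by move=> i; case: unliftP => [j|] ->; [exact: cy|exact: E].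
rewrite big_ord_recl unlift_none !scale1r.
under [in RHS]eq_bigr do rewrite liftK.
rewrite !indicE in_setC; case: (w \in A ord0) => /=.
  by rewrite mul1r mul0r addr0 scale1r addrA.
by rewrite mul1r mul0r add0r scale0r add0r.
Qed.

Lemma msection_norm u : msection u ->
  mfunction lambda (pmap1 (fun w (x : X w) => `|x|) u).
Proof.
case=> s ss su; have [c0 bc0] := bsec_ex.
have /choice[g gP] : forall n, exists g : T -> R, measurable_fun setT g /\
    \forall w \ae lambda, exists2 x, s n w = Some x & g w = complex.Re `|x|.
  move=> n; have [m [A [c [mA bc sE]]]] := ss n.
  have [g mg gE] := simple_norm mA bc (bsec_lin 0 0 bc0 bc0).
  exists g; split=> //; apply: filterS2 gE sE => w [x [y [c0x cy ->]]].
  move=> [z [cz ->]]; exists (\sum_(i < m) (\1_(A i) w : R)%:C *: z i) => //.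
  have -> : x = 0.
    move: c0x; rewrite /pmap2; case: (c0 w) => //= a [<-].
    by rewrite !scale0r addr0.
  have -> : z = y by apply/funext => i; have := cy i; rewrite cz => -[].
  by rewrite add0r.
have gE : \forall w \ae lambda, exists2 x, u w = Some x &
    g ^~ w @ \oo --> complex.Re `|x|.
  have := ae_foralln (fun n => (gP n).2).
  apply: filterS2 su => w [y [x [sy ux yx]]] gw; exists x => //.
  rewrite (_ : g ^~ w = fun n => complex.Re `|y n|); first exact: cvg_normRe.
  by apply/funext => n; have [z] := gw n; rewrite sy => -[->].
apply/mfunctionP.
exists (fun w => (complex.Re (odflt 0 (omap (fun x : X w => `|x|) (u w))))%:C).
split=> [||]; last 1 first.
- apply: filterS gE => w [x ux _]; rewrite /pmap1 ux /=; congr Some.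
  by rewrite RRe_real// normr_real.
- rewrite /=; case: gE => N [mN N0 gN].
  have mNC : measurable (~` N) by exact: measurableC.
  have mf : measurable_fun (~` N)
      (fun w => complex.Re (odflt 0 (omap (fun x : X w => `|x|) (u w)))).
    apply: (@measurable_fun_cvg _ _ _ _ g) => [n|w Nw].
      exact: measurable_funTS (gP n).1.
    have [x ->//] : exists2 x, u w = Some x & g ^~ w @ \oo --> complex.Re `|x|.
    by apply: contrapT => /gN.
  move/(measurable_restrictT _ mNC): mf; apply: (@ae_measurable_real _ _ _ lambda).
  exists N; split=> // w; apply: contra_notP => Nw.
  by rewrite /= patchE mem_set.
- exact: measurable_cst.
Qed.

Definition L0X : Type := aeclass lambda msection.
HB.instance Definition _ := Choice.on L0X.

Definition L0X_zero : L0X := cls lambda (AESection msection0).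
Definition L0X_opp : L0X -> L0X := lift1 msection_opp.
Definition L0X_add : L0X -> L0X -> L0X := lift2 msection_add.
Definition L0X_scale : L0 lambda -> L0X -> L0X := lift2 msection_scale.
Definition L0X_mul : L0X -> L0X -> L0X := lift2 msection_mul.
Definition L0X_star : L0X -> L0X := lift1 msection_star.
Definition L0X_norm : L0X -> L0 lambda := lift1 msection_norm.

Lemma L0X_addA : associative L0X_add.
Proof.
move=> x y z; case: (clsP x) (clsP y) (clsP z) => u -> [v ->] [w ->].
rewrite /L0X_add !lift2E; apply: cls_eq; apply: aeW => t /=; rewrite /pmap2.
by case: (aeval u t) (aeval v t) (aeval w t) => [a|] [b|] [c|]//=; rewrite addrA.
Qed.

Lemma L0X_addC : commutative L0X_add.
Proof.
move=> x y; case: (clsP x) (clsP y) => u -> [v ->].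
rewrite /L0X_add !lift2E; apply: cls_eq; apply: aeW => t /=; rewrite /pmap2.
by case: (aeval u t) (aeval v t) => [a|] [b|]//=; rewrite addrC.
Qed.

Lemma L0X_add0 : left_id L0X_zero L0X_add.
Proof.
move=> x; case: (clsP x) => u ->.
rewrite /L0X_add /L0X_zero !lift2E; apply: cls_eq; apply: aeW => t /=.
by rewrite /pmap2; case: (aeval u t) => [a|]//=; rewrite add0r.
Qed.

Lemma L0X_addN : left_inverse L0X_zero L0X_opp L0X_add.
Proof.
move=> x; case: (clsP x) => u ->.
rewrite /L0X_add /L0X_opp /L0X_zero lift1E !lift2E; apply: cls_eq.
apply: filterS (msection_defined (aevalP u)) => t.
by rewrite /pdom/= /pmap1 /pmap2; case: (aeval u t) => [a|]//= _; rewrite addNr.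
Qed.

HB.instance Definition _ :=
  GRing.isZmodule.Build L0X L0X_addA L0X_addC L0X_add0 L0X_addN.

Lemma L0X_scaleA (f g : L0 lambda) (x : L0X) :
  L0X_scale f (L0X_scale g x) = L0X_scale (f * g) x.
Proof.
case: (clsP f) (clsP g) (clsP x) => u -> [v ->] [w ->].
rewrite /L0X_scale /*%R/= /L0_mul !lift2E; apply: cls_eq.
apply: aeW => t /=; rewrite /pmap2.
by case: (aeval u t) (aeval v t) (aeval w t) => [a|] [b|] [c|]//=; rewrite scalerA.
Qed.

Lemma L0X_scale1 : left_id 1 L0X_scale.
Proof.
move=> x; case: (clsP x) => u ->.
rewrite /L0X_scale /1%R/= /L0_cst !lift2E; apply: cls_eq; apply: aeW => t /=.
by rewrite /pmap2; case: (aeval u t) => [a|]//=; rewrite scale1r.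
Qed.

Lemma L0X_scaleDr : right_distributive L0X_scale +%R.
Proof.
move=> x y z; case: (clsP x) (clsP y) (clsP z) => u -> [v ->] [w ->].
rewrite /L0X_scale /+%R/= /L0X_add !lift2E; apply: cls_eq.
apply: aeW => t /=; rewrite /pmap2.
by case: (aeval u t) (aeval v t) (aeval w t) => [a|] [b|] [c|]//=; rewrite scalerDr.
Qed.

Lemma L0X_scaleDl (x : L0X) : {morph L0X_scale ^~ x : f g / f + g}.
Proof.
move=> f g; case: (clsP f) (clsP g) (clsP x) => u -> [v ->] [w ->].
rewrite /L0X_scale /+%R/= /L0X_add /L0_add !lift2E; apply: cls_eq.
apply: aeW => t /=; rewrite /pmap2.
by case: (aeval u t) (aeval v t) (aeval w t) => [a|] [b|] [c|]//=; rewrite scalerDl.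
Qed.

HB.instance Definition _ := GRing.Zmodule_isLmodule.Build (L0 lambda) L0X
  L0X_scaleA L0X_scale1 L0X_scaleDr L0X_scaleDl.

End L0X.

Section L0X_dynamical_system.
Context d (T : measurableType d) (R : realType).
Context (lambda : complete_measure T R) (X : cstar_bundle lambda).
Implicit Types (x y e : L0X X).

Definition L0X_is_unit e := forall x, L0X_mul e x = x /\ L0X_mul x e = x.

Definition L0X_pos x := exists y, x = L0X_mul (L0X_star y) y.

Definition LinfX : set (L0X X) := [set x | Linf (L0X_norm x)].

Definition calLinfX : set (forall w, X w) :=
  [set u | msection (ptotal u) /\ calLinf lambda (fun w => `|u w|)].

(* Only the values of [l] on [LinfX] are relevant. *)
Record is_vector_lifting (p : L0 lambda -> T -> R[i])
    (l : L0X X -> forall w, X w) : Prop := {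
  vlifting_calLinf : forall x, LinfX x -> calLinfX (l x);
  vlifting_in_cls : forall x, LinfX x -> in_cls (ptotal (l x)) x;
  vlifting_norm : forall x, LinfX x -> forall w, `|l x w| = p (L0X_norm x) w;
  vliftingD : forall x y, LinfX x -> LinfX y ->
    forall w, l (x + y) w = l x w + l y w;
  vliftingZ : forall f x, Linf f -> LinfX x ->
    forall w, l (f *: x) w = p f w *: l x w;
  vlifting_star : forall x, LinfX x -> forall w, l (L0X_star x) w = star (l x w);
  vliftingM : forall x y, LinfX x -> LinfX y ->
    forall w, l (L0X_mul x y) w = cmul (l x w) (l y w);
  vlifting_dense : forall w, dense [set l x w | x in LinfX] }.

Definition L0X_is_state (phi : {scalar L0X X}) :=
  (forall x, L0X_pos x -> (0 : L0 lambda) <= phi x) /\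
  supremums [set L0_abs (phi x) | x in [set x | L0X_norm x <= 1]] 1.

Definition L0X_is_markov e (S : {linear L0X X -> L0X X}) :=
  (forall x, L0X_pos x -> L0X_pos (S x)) /\ S e = e.

Definition L0X_is_dynsys e (phi : {scalar L0X X})
    (S : {linear L0X X -> L0X X}) :=
  [/\ L0X_is_unit e, L0X_is_state phi, L0X_is_markov e S
    & forall x, phi (S x) = phi x].

Definition bo_cvg (u : nat -> L0X X) (x : L0X X) :=
  o_cvg (fun n => L0X_norm (u n - x)) 0.

(* The averages are indexed so that the sequence starts with one summand.     *)
Definition L0X_uniquely_ergodic e (phi : {scalar L0X X})
    (S : {linear L0X X -> L0X X}) :=
  forall x, bo_cvg (fun n =>
    L0_cst lambda n.+1%:R^-1 *: \sum_(k < n.+1) iter k S x) (phi x *: e).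

Record dynsys_bundle := {
  bstate : forall w, {scalar X w};
  bmarkov : forall w, {linear X w -> X w};
  bdynsys : forall w, is_dynsys (bstate w) (bmarkov w);
  bmarkov_meas : forall u, @msection _ _ _ _ X u -> msection (pmap1 bmarkov u);
  bstate_meas : forall u, @msection _ _ _ _ X u ->
    mfunction lambda (pmap1 bstate u) }.

Definition hat_state (D : dynsys_bundle) : L0X X -> L0 lambda :=
  lift1 (@bstate_meas D).

Definition hat_markov (D : dynsys_bundle) : L0X X -> L0X X :=
  lift1 (@bmarkov_meas D).

End L0X_dynamical_system.

(* Main.v *)
(** In each fibre, a Hahn-Banach argument shows that unique ergodicity forces
    norm convergence: on self-adjoint elements the limsup of the suprema of the
    spectra of the Birkhoff averages is sublinear, and the linear functionals it
    dominates are invariant states; if there is only one invariant state,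
    this limsup is linear, and applying this to [h] and [- h] squeezes the
    averages of [h]. The order on a C*-algebra is handled without spectra: [x]
    is positive iff it is self-adjoint and [|c - x| <= c] for some [c >= 0],
    square roots come from a contraction iteration, and [star y ** y] is positive
    by Kaplansky's argument. The fibrewise convergence is an a.e. convergence of
    measurable norms, hence an order convergence in [L0] (dominated by the tail
    suprema). The lifting is used to see that the unit of [L0(Omega, X)] is
    represented by the units of all the fibres. *)
From HB Require Import structures.
Require Import Defs.
From mathcomp Require Import all_boot all_order all_algebra.
From mathcomp Require Import all_classical all_reals all_analysis.
From mathcomp Require Import measurable_realfun complex ring lra.
Set Implicit Arguments.
Unset Strict Implicit.
Unset Printing Implicit Defensive.
Import Order.TTheory GRing.Theory Num.Theory.
Import numFieldNormedType.Exports.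
Local Open Scope classical_set_scope.
Local Open Scope complex_scope.
Local Open Scope ring_scope.

(** * Linear identities in modules *)

(* A module embeds into its square-zero extension, which is a commutative ring:
   this lets [ring] decide linear identities in modules. *)
Section square_zero_extension.
Context (K : comNzRingType) (V : lmodType K).

Definition sqz : Type := (K * V)%type.
HB.instance Definition _ := GRing.Zmodule.on sqz.

Definition sqz_one : sqz := (1, 0).
Definition sqz_mul (x y : sqz) : sqz := (x.1 * y.1, x.1 *: y.2 + y.1 *: x.2).

Let mulA : associative sqz_mul.
Proof.
move=> [a x] [b y] [c z]; rewrite /sqz_mul/=; congr pair; first exact: mulrA.
by rewrite !scalerDr !scalerA addrA (mulrC c a) (mulrC c b).
Qed.

Let mulC : commutative sqz_mul.
Proof. by move=> [a x] [b y]; rewrite /sqz_mul/= mulrC addrC. Qed.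

Let mul1 : left_id sqz_one sqz_mul.
Proof. by move=> [a x]; rewrite /sqz_mul/= mul1r scale1r scaler0 addr0. Qed.

Let mulD : left_distributive sqz_mul +%R.
Proof.
move=> [a x] [b y] [c z]; rewrite /sqz_mul /+%R/= /add_pair/=.
by congr pair; rewrite ?mulrDl// scalerDl scalerDr addrACA.
Qed.

Let oner_neq0 : sqz_one != 0.
Proof. by apply/eqP => -[/eqP]; rewrite oner_eq0. Qed.

HB.instance Definition _ :=
  GRing.Zmodule_isComNzRing.Build sqz mulA mulC mul1 mulD oner_neq0.

Definition sqz_scal (a : K) : sqz := (a, 0).
Definition sqz_vec (x : V) : sqz := (0, x).

Let scal_is_zmod : zmod_morphism sqz_scal.
Proof. by move=> a b; congr pair; rewrite subr0. Qed.

Let scal_is_monoid : monoid_morphism sqz_scal.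
Proof.
by split=> // a b; rewrite /sqz_scal/= /*%R/= /sqz_mul/= !scaler0 addr0.
Qed.

HB.instance Definition _ :=
  GRing.isZmodMorphism.Build K sqz sqz_scal scal_is_zmod.
HB.instance Definition _ :=
  GRing.isMonoidMorphism.Build K sqz sqz_scal scal_is_monoid.

Lemma sqz_vec_inj : injective sqz_vec. Proof. by move=> x y []. Qed.
Lemma sqz_vec0 : sqz_vec 0 = 0. Proof. by []. Qed.
Lemma sqz_vecD x y : sqz_vec (x + y) = sqz_vec x + sqz_vec y.
Proof. by congr pair; rewrite addr0. Qed.
Lemma sqz_vecN x : sqz_vec (- x) = - sqz_vec x.
Proof. by congr pair; rewrite oppr0. Qed.
Lemma sqz_vecZ a x : sqz_vec (a *: x) = sqz_scal a * sqz_vec x.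
Proof. by rewrite /*%R/= /sqz_mul/= mulr0 scale0r addr0. Qed.
Lemma sqz_vecMn x n : sqz_vec (x *+ n) = sqz_vec x *+ n.
Proof. by elim: n => // n IH; rewrite !mulrS sqz_vecD IH. Qed.
Definition sqzE := (sqz_vec0, sqz_vecD, sqz_vecN, sqz_vecZ, sqz_vecMn).
End square_zero_extension.

Ltac lmodring := apply: sqz_vec_inj; rewrite !sqzE; ring.

(** * Real-valued norms and positivity in a unital C*-algebra *)

Section real_norm.
Context (R : realType).

Definition nrm (V : normedModType R[i]) (x : V) : R := complex.Re `|x|.

Section normed_module.
Context (V : normedModType R[i]).
Implicit Types x y : V.

Lemma nrmE x : `|x| = (nrm x)%:C.
Proof. by rewrite /nrm RRe_real// normr_real. Qed.

Lemma nrm_ge0 x : 0 <= nrm x.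
Proof. by rewrite -ler0c -nrmE. Qed.

Lemma nrm_le x (a : R) : (nrm x <= a) = (`|x| <= a%:C).
Proof. by rewrite nrmE lecR. Qed.

Lemma nrmD x y : nrm (x + y) <= nrm x + nrm y.
Proof. by rewrite nrm_le rmorphD/= -!nrmE ler_normD. Qed.

Lemma nrmN x : nrm (- x) = nrm x.
Proof. by rewrite /nrm normrN. Qed.

Lemma nrmB x y : nrm (x - y) <= nrm x + nrm y.
Proof. by rewrite -[nrm y]nrmN nrmD. Qed.

Lemma nrm_distC x y : nrm (x - y) = nrm (y - x).
Proof. by rewrite -nrmN opprB. Qed.

Lemma nrm0 : nrm (0 : V) = 0.
Proof. by rewrite /nrm normr0. Qed.

Lemma nrm0_eq0 x : nrm x <= 0 -> x = 0.
Proof. by rewrite nrm_le normr_le0 => /eqP. Qed.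

Lemma nrmZ (a : R[i]) x : nrm (a *: x) = complex.Re `|a| * nrm x.
Proof.
by apply: complexI; rewrite rmorphM/= -!nrmE normrZ.
Qed.

Lemma nrmZr (a : R) x : nrm (a%:C *: x) = `|a| * nrm x.
Proof. by rewrite nrmZ normc_def/= expr0n/= addr0 sqrtr_sqr. Qed.

Lemma cvg_nrmP (u : nat -> V) (x : V) :
  u @ \oo --> x <->
  forall e : R, 0 < e -> \forall n \near \oo, nrm (x - u n) < e.
Proof.
split=> [/cvgrPdist_lt ux e e0|ux].
  have /ux : (0 : R[i]) < e%:C by rewrite ltcR.
  by apply: filterS => n; rewrite nrmE ltcR.
apply/cvgrPdist_lt => e e0.
have er : e = (complex.Re e)%:C by rewrite RRe_real// gtr0_real.
by move: e0; rewrite er ltcR => /ux; apply: filterS => n; rewrite nrmE ltcR.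
Qed.

Lemma cvg_nrm_le (u : nat -> V) (x : V) (a : R) :
  u @ \oo --> x -> (forall n, nrm (u n) <= a) -> nrm x <= a.
Proof.
move=> /cvg_nrmP ux ua; apply/ler_addgt0Pr => e /ux[n _ /(_ n (leqnn n))/= h].
rewrite -(subrK (u n) x) addrC (le_trans (nrmD _ _))// lerD// ltW//.
Qed.

End normed_module.

(** Telescoping: the increments of [y] are majorized by those of [h], which is nondecreasing and
    bounded, so [y] is Cauchy. *)
Lemma cvg_dominated (V : completeNormedModType R[i]) (y : nat -> V)
    (h : nat -> R) (M : R) :
  (forall n, nrm (y n.+1 - y n) <= h n.+1 - h n) -> (forall n, h n <= M) ->
  cvgn y.
Proof.
move=> yh hM.
have yh' m k : nrm (y (m + k)%N - y m) <= h (m + k)%N - h m.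
  elim: k => [|k IH]; first by rewrite addn0 !subrr nrm0.
  rewrite addnS -[y _.+1](subrK (y (m + k)%N)) -addrA (le_trans (nrmD _ _))//.
  by rewrite (le_trans (lerD (yh _) IH))// addrA subrK.
have hnd : nondecreasing_seq h.
  apply/nondecreasing_seqP => n; rewrite -subr_ge0.
  exact: le_trans (nrm_ge0 _) (yh n).
have hc : cvgn h.
  by apply: nondecreasing_is_cvgn => //; exists M => _ [n _ <-].
apply/cauchy_cvgP/cauchy_exP => e e0.
have er : e = (complex.Re e)%:C by rewrite RRe_real// gtr0_real.
move: e0; rewrite er ltcR => e0.
have /cvgrPdist_lt/(_ _ e0)[N _ hN] := hc.
exists (y N); exists N => // n /= Nn.
rewrite -ball_normE /= nrmE ltcR nrm_distC -(subnKC Nn).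
apply: le_lt_trans (yh' _ _) _.
have := hN _ (leqnn N) => /=; rewrite ger0_norm; last first.
  by rewrite subr_ge0; exact: nondecreasing_cvgn_le.
apply: le_lt_trans; rewrite lerD2r.
exact: nondecreasing_cvgn_le.
Qed.

End real_norm.

(** * Square roots and the positive cone of a unital C*-algebra *)

Section unital_cstar.
Context (R : realType) (A : cstarAlgType R) (e : A).
Hypothesis he : is_unit e.
Implicit Types (x y z s r h : A) (c : R).

Local Notation "x ** y" := (cmul x y) (at level 40, left associativity).
Local Notation comm x y := (x ** y = y ** x).

Lemma cmul1x x : e ** x = x. Proof. by have [] := he x. Qed.
Lemma cmulx1 x : x ** e = x. Proof. by have [] := he x. Qed.
Lemma cmulNx x y : - x ** y = - (x ** y).
Proof. by rewrite -sub0r cmulBl cmul0x sub0r. Qed.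
Lemma cmulxN x y : x ** - y = - (x ** y).
Proof. by rewrite -sub0r cmulBr cmulx0 sub0r. Qed.
Lemma starN x : star (- x) = - star x.
Proof. by rewrite -sub0r starB star0 sub0r. Qed.
Lemma starZr c x : star (c%:C *: x) = c%:C *: star x.
Proof. by rewrite starZ conjc_real. Qed.
Lemma starZi x : star ('i *: x) = - ('i *: star x).
Proof. by rewrite starZ -scaleNr; congr (_ *: _); rewrite /GRing.opp/= oppr0. Qed.

Lemma star1 : star e = e.
Proof.
have se : star (e ** star e) = e ** star e by rewrite starM starK.
by move: se; rewrite cmul1x starK.
Qed.

Definition cmulE :=
  (@cmulDl R A, @cmulDr R A, cmulNx, cmulxN, @cmulZl R A, @cmulZr R A,
   cmul1x, cmulx1, @cmulA R A).
Definition starE := (@starD R A, starN, starZr, starZi, @starM R A, @starK R A, star1).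

Lemma nrmM x y : nrm (x ** y) <= nrm x * nrm y.
Proof. by rewrite nrm_le rmorphM/= -!nrmE norm_cmul. Qed.

Lemma nrm_cstar x : nrm (star x ** x) = nrm x ^+ 2.
Proof. by apply: complexI; rewrite rmorphXn/= -!nrmE norm_cstar. Qed.

Lemma nrm_sq x : star x = x -> nrm (x ** x) = nrm x ^+ 2.
Proof. by move=> sx; rewrite -nrm_cstar sx. Qed.

Lemma nrm_star x : nrm (star x) = nrm x.
Proof. by rewrite /nrm norm_star. Qed.

Lemma nrm_unit_le1 : nrm e <= 1.
Proof.
have := nrm_cstar e; rewrite star1 cmul1x; have := nrm_ge0 e; nra.
Qed.

(** Iteration for the fixed-point equation [y = (h + y ** y) / 2], which says that [e - y] is a
    square root of [e - h]. The scalar iteration [sqrt_bound], with [1] in place of [h], majorizes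
    it. *)
Fixpoint sqrt_approx h n : A :=
  if n is n'.+1 then
    (2^-1)%:C *: (h + sqrt_approx h n' ** sqrt_approx h n') else 0.

Fixpoint sqrt_bound n : R :=
  if n is n'.+1 then 2^-1 * (1 + sqrt_bound n' * sqrt_bound n') else 0.

Lemma sqrt_approxS h n : sqrt_approx h n.+1 =
  (2^-1)%:C *: (h + sqrt_approx h n ** sqrt_approx h n).
Proof. by []. Qed.

Lemma sqrt_boundS n :
  sqrt_bound n.+1 = 2^-1 * (1 + sqrt_bound n * sqrt_bound n).
Proof. by []. Qed.

Lemma sqrt_bound_itv n : 0 <= sqrt_bound n <= 1.
Proof.
elim: n => [|n /andP[h0 h1]] /=; first by rewrite lexx ler01.
by apply/andP; split; nra.
Qed.

Lemma nrm_sqrt_approx h n : nrm h <= 1 -> nrm (sqrt_approx h n) <= sqrt_bound n.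
Proof.
move=> h1; elim: n => [|n IH] /=; first by rewrite nrm0.
rewrite nrmZr ger0_norm ?invr_ge0// ler_wpM2l ?invr_ge0//.
apply: le_trans (nrmD _ _) _; apply: lerD => //.
by apply: le_trans (nrmM _ _) _; apply: ler_pM => //; exact: nrm_ge0.
Qed.

(** The splitting of [x ** x - y ** y] as [x ** (x - y) + (x - y) ** y] needs no commutativity, and
    the scalar majorant satisfies the same recursion with equality. *)
Lemma sqrt_approxB h n : nrm h <= 1 ->
  nrm (sqrt_approx h n.+1 - sqrt_approx h n) <= sqrt_bound n.+1 - sqrt_bound n.
Proof.
move=> h1; elim: n => [|n IH].
  rewrite /= cmul0x mulr0 !addr0 !subr0 nrmZr ger0_norm ?invr_ge0//.
  by rewrite ler_wpM2l ?invr_ge0.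
have xE : sqrt_approx h n.+2 - sqrt_approx h n.+1 = (2^-1)%:C *:
    (sqrt_approx h n.+1 ** (sqrt_approx h n.+1 - sqrt_approx h n) +
     (sqrt_approx h n.+1 - sqrt_approx h n) ** sqrt_approx h n).
  by rewrite sqrt_approxS [X in _ - X = _]sqrt_approxS !cmulE; lmodring.
have bE : sqrt_bound n.+2 - sqrt_bound n.+1 = 2^-1 *
    ((sqrt_bound n.+1 + sqrt_bound n) * (sqrt_bound n.+1 - sqrt_bound n)).
  by rewrite sqrt_boundS [X in _ - X = _]sqrt_boundS; ring.
rewrite xE bE.
have := nrm_sqrt_approx n h1; have := nrm_sqrt_approx n.+1 h1; move: IH.
have := sqrt_bound_itv n; have := sqrt_bound_itv n.+1.
move: (sqrt_approx h n.+1) (sqrt_approx h n) (sqrt_bound n.+1) (sqrt_bound n).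
move=> x y a b /andP[a0 a1] /andP[b0 b1] xy xa yb.
rewrite nrmZr ger0_norm ?invr_ge0// ler_wpM2l ?invr_ge0//.
apply: le_trans (nrmD _ _) _; rewrite mulrDl lerD//.
  by apply: le_trans (nrmM _ _) _; rewrite ler_pM ?nrm_ge0.
by apply: le_trans (nrmM _ _) _; rewrite mulrC ler_pM ?nrm_ge0.
Qed.

Lemma star_sqrt_approx h n : star h = h -> star (sqrt_approx h n) = sqrt_approx h n.
Proof.
by move=> sh; elim: n => [|n IH] /=; rewrite ?star0// !starE IH sh.
Qed.

Lemma comm_sqrt_approx h n z : comm z h -> comm z (sqrt_approx h n).
Proof.
move=> zh; elim: n => [|n IH] /=; rewrite ?cmul0x ?cmulx0// !cmulE zh IH.
by rewrite -!cmulA IH.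
Qed.

(** The commutation clause stands in for functional calculus: what commutes with [h] commutes with
    every iterate, hence with the limit. The bound on [e - s] makes [s] itself positive. *)
Lemma sqrt_exists h : star h = h -> nrm h <= 1 -> exists s,
  [/\ star s = s, s ** s = e - h, nrm (e - s) <= 1
    & forall z, comm z h -> comm z s].
Proof.
move=> sh h1.
have cy : cvgn (sqrt_approx h).
  apply: (@cvg_dominated _ _ _ sqrt_bound 1) => n; first exact: sqrt_approxB.
  by case/andP: (sqrt_bound_itv n).
set y := limn (sqrt_approx h) in cy.
have sy : star y = y.
  have := cvg_star cy; under eq_fun do rewrite star_sqrt_approx//.
  by move/cvg_unique; apply.
have yE : y + y = h + y ** y.
  have : (fun n => sqrt_approx h n.+1) @ \oo --> (2^-1)%:C *: (h + y ** y).
    apply: cvgZ; first exact: cvg_cst.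
    by apply: cvgD; [exact: cvg_cst|exact: cvg_cmul].
  have : (fun n => sqrt_approx h n.+1) @ \oo --> y by rewrite cvg_shiftS.
  move/cvg_unique => /[apply] yE; rewrite {1 2}yE//.
  by rewrite -scalerDl -rmorphD/= (_ : _ + _ = 1) ?scale1r//; lra.
exists (e - y); split.
- by rewrite !starE sy.
- rewrite !cmulE; have -> : h = y + y - y ** y by rewrite yE addrK.
  lmodring.
- rewrite opprB addrC subrK; apply: cvg_nrm_le cy _ => n.
  by apply: le_trans (nrm_sqrt_approx _ h1) _; case/andP: (sqrt_bound_itv n).
- move=> z zh; rewrite !cmulE; congr (_ - _).
  have : (fun n => z ** sqrt_approx h n) @ \oo --> z ** y.
    by apply: cvg_cmul => //; exact: cvg_cst.
  have : (fun n => z ** sqrt_approx h n) @ \oo --> y ** z.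
    under eq_fun do rewrite comm_sqrt_approx//.
    by apply: cvg_cmul => //; exact: cvg_cst.
  by move/cvg_unique => /[apply] ->.
Qed.

Lemma mulcii : 'i * 'i = -1 :> R[i].
Proof. by rewrite -expr2 sqr_i. Qed.

(** For [u = s + 'i *: r], commutation gives [star u ** u = s ** s + r ** r], while
    [u ** u + star u ** star u] is twice [s ** s - r ** r]; the C*-identity compares the two. *)
Lemma nrm_sqB_le s r : star s = s -> star r = r -> comm s r ->
  nrm (s ** s - r ** r) <= nrm (s ** s + r ** r).
Proof.
move=> ss sr sr_comm; pose u := s + 'i *: r.
have su : star u = s - 'i *: r by rewrite !starE ss sr.
have uu : star u ** u = s ** s + r ** r.
  by rewrite su !cmulE sr_comm ?scalerN !scalerA mulcii; lmodring.
have u2 : 2%:C *: (s ** s - r ** r) = u ** u + star u ** star u.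
  by rewrite su !cmulE sr_comm ?scalerN !scalerA mulcii; lmodring.
have : nrm (2%:C *: (s ** s - r ** r)) <= 2 * nrm (star u ** u).
  rewrite u2 nrm_cstar; apply: le_trans (nrmD _ _) _.
  by have := nrmM u u; have := nrmM (star u) (star u); rewrite nrm_star; nra.
by rewrite nrmZr ger0_norm// uu ler_pM2l.
Qed.

(** For self-adjoint [x], the bound says that the spectrum lies in [[0, 2c]]. With [c] left free,
    stability under sums is immediate: the constants add up. *)
Definition npos x := star x = x /\ exists2 c, 0 <= c & nrm (c%:C *: e - x) <= c.

Lemma npos_subr c h : star h = h -> nrm h <= c -> npos (c%:C *: e - h).
Proof.
move=> sh hc; split; first by rewrite !starE sh.
exists c; first exact: le_trans (nrm_ge0 _) hc.
by rewrite opprB addrC subrK.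
Qed.

Lemma nposD x y : npos x -> npos y -> npos (x + y).
Proof.
move=> [sx [a a0 xa]] [sy [b b0 yb]]; split; first by rewrite !starE sx sy.
exists (a + b); first exact: addr_ge0.
have -> : (a + b)%:C *: e - (x + y) = (a%:C *: e - x) + (b%:C *: e - y).
  by lmodring.
by rewrite (le_trans (nrmD _ _))// lerD.
Qed.

Lemma nposZ c x : 0 <= c -> npos x -> npos (c%:C *: x).
Proof.
move=> c0 [sx [a a0 xa]]; split; first by rewrite !starE sx.
exists (c * a); first exact: mulr_ge0.
have -> : (c * a)%:C *: e - c%:C *: x = c%:C *: (a%:C *: e - x) by lmodring.
by rewrite nrmZr ger0_norm// ler_wpM2l.
Qed.

(** Unless [c = 0], which forces [x = 0], rescaling writes [x] as [c *: (e - h)] with [nrm h <= 1],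
    to which [sqrt_exists] applies. *)
Lemma npos_sqrt x : npos x ->
  exists s, [/\ npos s, s ** s = x & forall z, comm z x -> comm z s].
Proof.
move=> [sx [c]]; rewrite le_eqVlt => /predU1P[<-|c0] xc.
  move: xc; rewrite scale0r sub0r nrmN => /nrm0_eq0 ->.
  exists 0; split=> //; last by rewrite cmul0x.
  by split; [rewrite star0|exists 0; rewrite // scale0r subr0 nrm0].
have ci0 : 0 <= c^-1 by rewrite invr_ge0 ltW.
pose h := c^-1%:C *: (c%:C *: e - x).
have [||s [ss s2 s1 sz]] := @sqrt_exists h.
- by rewrite !starE sx.
- by rewrite nrmZr ger0_norm// ler_pdivrMl// mulr1.
have xE : c%:C *: (e - h) = x.
  by rewrite scalerBr scalerA -rmorphM/= divff ?gt_eqF// scale1r opprB addrC subrK.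
have sc : Num.sqrt c * Num.sqrt c = c by rewrite -expr2 sqr_sqrtr// ltW.
exists ((Num.sqrt c)%:C *: s); split.
- apply: nposZ; first exact: sqrtr_ge0.
  by split=> //; exists 1; rewrite ?ler01// scale1r.
- by rewrite !cmulE scalerA -rmorphM/= sc s2.
- move=> z zx; rewrite !cmulE; congr (_ *: _); apply: sz.
  by rewrite /h !cmulE zx.
Qed.

(** With [c = nrm s ^+ 2], the element [c - s ** s] is a square [r ** r]. Comparing
    [r ** r - s ** s] with [r ** r + s ** s = c] bounds [c - 2 (s ** s)] by [c]; averaging with [c]
    bounds [c - s ** s]. *)
Lemma npos_sq s : star s = s -> npos (s ** s).
Proof.
move=> ss; set c := nrm s ^+ 2.
have c0 : 0 <= c by exact: sqr_ge0.
have ssq : star (s ** s) = s ** s by rewrite starM ss.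
have /npos_sqrt[r [[sr _] r2 rz]] : npos (c%:C *: e - s ** s).
  by apply: npos_subr; rewrite // nrm_sq.
have rs : comm s r by apply: rz; rewrite !cmulE.
split=> //; exists c => //.
have := nrm_sqB_le sr ss (esym rs); rewrite r2 subrK nrmZr ger0_norm// => h.
have {}h := le_trans h (ler_wpM2l c0 nrm_unit_le1).
have : nrm (2%:C *: (c%:C *: e - s ** s)) <= 2 * c.
  have -> : 2%:C *: (c%:C *: e - s ** s) =
    c%:C *: e + (c%:C *: e - s ** s - s ** s) by lmodring.
  apply: le_trans (nrmD _ _) _; rewrite nrmZr ger0_norm//.
  have := ler_wpM2l c0 nrm_unit_le1; lra.
by rewrite nrmZr ger0_norm// ler_pM2l.
Qed.

Lemma npos1 : npos e.
Proof. by rewrite -[X in npos X]cmul1x; apply: npos_sq; exact: star1. Qed.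

Lemma nposM x y : npos x -> npos y -> comm x y -> npos (x ** y).
Proof.
move=> /npos_sqrt[s [[ss _] <- sz]] /npos_sqrt[r [[sr _] <- rz]] xy.
have rs : comm r s by apply: sz; apply/esym/rz.
have -> : s ** s ** (r ** r) = (s ** r) ** (s ** r).
  by rewrite !cmulA -(cmulA s r s) rs !cmulA.
by apply: npos_sq; rewrite starM ss sr.
Qed.

(** With [c - h = s ** s] and [c + h = r ** r], the difference of the squares is [- 2 h] and their
    sum is [2 c], so [nrm_sqB_le] applies. *)
Lemma nrm_le_npos h c : 0 <= c ->
  npos (c%:C *: e - h) -> npos (c%:C *: e + h) -> nrm h <= c.
Proof.
move=> c0 /npos_sqrt[s [[ss _] s2 sz]] /npos_sqrt[r [[sr _] r2 rz]].
have hs : comm h s by apply: sz; rewrite !cmulE.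
have sr_comm : comm s r by apply: rz; rewrite !cmulE hs.
have := nrm_sqB_le ss sr sr_comm; rewrite s2 r2.
have -> : c%:C *: e - h - (c%:C *: e + h) = - (2%:C *: h) by lmodring.
have -> : c%:C *: e - h + (c%:C *: e + h) = (2 * c)%:C *: e by lmodring.
rewrite nrmN !nrmZr !ger0_norm ?mulr_ge0// => h2.
have := ler_wpM2l c0 nrm_unit_le1; lra.
Qed.

Lemma nrm_npos_le x c : 0 <= c -> npos x -> npos (c%:C *: e - x) -> nrm x <= c.
Proof.
move=> c0 px pcx; apply: nrm_le_npos => //.
by apply: nposD => //; apply: nposZ => //; exact: npos1.
Qed.

(* With [q = z ** star z] and [c = nrm m], the element
   [w = (c - q) ** z = z ** (c + m)] has norm at most [c * nrm z], whereas
   [star w ** w = - m ** (c + m) ^ 2]: this forces [c = 0]. *)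
Lemma npos_opp_star_self m z :
  star z ** z = - m -> npos m -> npos (z ** star z) -> m = 0.
Proof.
move=> zm pm; set q := z ** star z => pq; set c := nrm m.
have [sm _] := pm; have [sq _] := pq.
have [c0|c_gt0] := leP c 0; first exact: nrm0_eq0.
have c0 := ltW c_gt0.
have cz : nrm z ^+ 2 = c by rewrite -nrm_cstar zm nrmN.
have cq : nrm q = c by rewrite /q -[X in X ** _]starK nrm_cstar nrm_star.
have pcq : npos (c%:C *: e - q) by apply: npos_subr; rewrite // cq.
have ncq : nrm (c%:C *: e - q) <= c.
  by apply: nrm_npos_le; rewrite // opprB addrC subrK.
have zz x : star z ** (z ** x) = - (m ** x) by rewrite cmulA zm cmulNx.
pose w := (c%:C *: e - q) ** z.
have wE : w = z ** (c%:C *: e + m).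
  by rewrite /w /q cmulBl -cmulA zm !cmulE opprK.
have nw : nrm w ^+ 2 <= c ^+ 3.
  have nw : nrm w <= c * nrm z.
    apply: le_trans (nrmM _ _) _; rewrite ler_wpM2r//; exact: nrm_ge0.
  have -> : c ^+ 3 = (c * nrm z) ^+ 2 by rewrite exprMn cz -exprSr.
  rewrite ler_pXn2r// nnegrE ?nrm_ge0//.
  exact: mulr_ge0 c0 (nrm_ge0 z).
pose n := c%:C *: (c%:C *: m) + c%:C *: (m ** m) *+ 2 + m ** (m ** m).
have ww : star w ** w = - n.
  rewrite wE starM !starE sm -cmulA zz /n !cmulE; lmodring.
have pn : npos ((c ^+ 3)%:C *: e - n).
  apply: npos_subr; last by rewrite -nrmN -ww nrm_cstar.
  by rewrite /n mulr2n !starE sm !cmulA.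
have pm3 : npos (m ** (m ** m)) by apply: nposM; rewrite ?cmulA//; exact: npos_sq.
have pcm : npos (c%:C *: e - m) by apply: npos_subr.
have pd : npos ((c%:C *: e - m) ** (c%:C *: e - m)).
  by apply: npos_sq; rewrite !starE sm.
(* Adding the positive elements [m ^ 3] and [2 c (c - m) ^ 2] to [c ^ 3 - n] cancels the cubic and
   quadratic terms and leaves [3 c ^ 3 - 5 c ^ 2 m]. Hence [nrm m <= 3 c / 5], against
   [nrm m = c > 0]. *)
pose a := c * (3 / 5); have a0 : 0 <= a by rewrite mulr_ge0.
have a5 : 5 * a = 3 * c by rewrite /a; field.
have pam : npos (a%:C *: e - m).
  have -> : a%:C *: e - m = ((5 * c ^+ 2)^-1)%:C *:
     ((c ^+ 3)%:C *: e - n + m ** (m ** m) +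
      (2 * c)%:C *: ((c%:C *: e - m) ** (c%:C *: e - m))).
    have -> : (c ^+ 3)%:C *: e - n + m ** (m ** m) +
        (2 * c)%:C *: ((c%:C *: e - m) ** (c%:C *: e - m)) =
        (c ^+ 2 * (3 * c))%:C *: e - (5 * c ^+ 2)%:C *: m.
      by rewrite /n !cmulE; lmodring.
    rewrite -a5; have -> : c ^+ 2 * (5 * a) = 5 * c ^+ 2 * a by ring.
    rewrite (rmorphM _ (5 * c ^+ 2))/= -scalerA -scalerBr scalerA -rmorphM/=.
    by rewrite mulVf ?scale1r// mulf_neq0 ?expf_neq0 ?gt_eqF.
  apply: nposZ; first by rewrite invr_ge0 mulr_ge0// sqr_ge0.
  apply: nposD; first exact: nposD.
  by apply: nposZ => //; rewrite mulr_ge0.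
have : 5 * c <= 3 * c by rewrite -a5 ler_pM2l//; exact: nrm_npos_le.
by rewrite ler_pM2r// ler_nat.
Qed.

Lemma npos_star_self y : npos (star y ** y).
Proof.
have sk : star (star y ** y) = star y ** y by rewrite starM starK.
move: sk; move yk : (star y ** y) => k sk.
have /npos_sqrt[a [pa a2 az]] : npos (k ** k) by exact: npos_sq.
have [sa _] := pa.
have ka : comm k a by apply: az; rewrite cmulA.
(* [a] is the absolute value of [k], so [p] is twice the negative part of [k]; the aim is
   [p = 0]. *)
pose p := a - k; have sp : star p = p by rewrite !starE sa sk.
have ap : comm a p by rewrite /p !cmulE ka.
have pk : p ** k = - (a ** p) by rewrite /p !cmulE a2; lmodring.
pose z := y ** p; pose m := a ** (p ** p).
have pm : npos m.
  by apply: nposM => //; [exact: npos_sq|rewrite cmulA ap -!cmulA ap].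
have zm : star z ** z = - m.
  rewrite /z starM sp -!cmulA (cmulA (star y)) yk (cmulA p k) pk /m.
  by rewrite cmulNx !cmulA.
have pq : npos (z ** star z).
  (* Up to real factors, [u] and [v] are the real and imaginary parts of [z]. Half of
     [u ** u + v ** v] is [z ** star z + star z ** z], and the second term is [- m]. *)
  pose u := z + star z; pose v := 'i *: (z - star z).
  have su : star u = u by rewrite /u !starE addrC.
  have sv : star v = v by rewrite /v !starE; lmodring.
  have -> : z ** star z = (2^-1)%:C *: (u ** u + v ** v) + m.
    have uv : u ** u + v ** v = 2%:C *: (z ** star z + star z ** z).
      by rewrite /u /v !cmulE !(scalerDr, scalerN, scalerA) !mulcii; lmodring.
    by rewrite uv scalerA -rmorphM/= mulVf// scale1r zm subrK.
  apply: nposD => //; apply: nposZ; first by rewrite invr_ge0.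
  by apply: nposD; exact: npos_sq.
have m0 := npos_opp_star_self zm pm pq.
(* From [a ** (p ** p) = 0], the C*-identity for [b ** p] gives [b ** p = 0], then [a ** p = 0]; and
   [p ** p] is twice [a ** p]. *)
have [b [[sb _] b2 bz]] := npos_sqrt pa.
have pb : comm p b by exact: bz.
have bp0 : b ** p = 0.
  apply: nrm0_eq0; have : nrm (b ** p) ^+ 2 <= 0.
    rewrite -nrm_cstar starM sb sp -cmulA (cmulA b b) b2.
    by rewrite cmulA -ap -cmulA -/m m0 nrm0.
  have := nrm_ge0 (b ** p); nra.
have ap0 : a ** p = 0 by rewrite -b2 -cmulA bp0 cmulx0.
have p0 : p = 0.
  apply: nrm0_eq0; have : nrm p ^+ 2 <= 0.
    have pp : p ** p = 2%:C *: (a ** p) by rewrite /p !cmulE ka a2; lmodring.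
    by rewrite -nrm_sq// pp ap0 scaler0 nrm0.
  have := nrm_ge0 p; nra.
by have -> : k = a by apply/eqP; rewrite eq_sym -subr_eq0 -/p p0.
Qed.

Lemma npos_cstar_pos x : npos x <-> cstar_pos x.
Proof.
split=> [/npos_sqrt[s [[ss _] <- _]]|[y ->]]; last exact: npos_star_self.
by exists s; rewrite ss.
Qed.

End unital_cstar.

(** * The Hahn-Banach theorem *)

Section hahn_banach.
Context (R : realType) (V : lmodType R).
Implicit Types (p q f : V -> R) (x y : V).

(** Homogeneity is only required as an inequality, which is easier to check for infima; [sublinearZ]
    recovers the equality. *)
Definition sublinear q :=
  (forall x y, q (x + y) <= q x + q y) /\
  (forall a x, 0 <= a -> q (a *: x) <= a * q x).

Lemma sublinear0 q : sublinear q -> q 0 = 0.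
Proof.
move=> [qD qZ]; apply/eqP; rewrite eq_le.
have := qZ 0 0 (lexx 0); have := qD 0 0; rewrite scale0r mul0r addr0.
by move=> + ->/=; rewrite -{1}[q 0]addr0 lerD2l.
Qed.

Lemma sublinear_ge q x y : sublinear q -> q y - q (- x) <= q (x + y).
Proof.
move=> [qD _]; rewrite lerBlDr.
by have := qD (x + y) (- x); rewrite addrAC subrr add0r.
Qed.

(** Common core of three infima: the shift of a functional, the lower bound of a chain, and
    [upper_mean]. Near-optimal elements at [x] and [y] combine into a competitor at [x + y]. *)
Lemma sublinear_inf (E : V -> set R) :
  (forall x, E x !=set0) -> (forall x, has_lbound (E x)) ->
  (forall x y a b, E x a -> E y b -> exists2 c, E (x + y) c & c <= a + b) ->
  (forall t x a, 0 <= t -> E x a -> exists2 b, E (t *: x) b & b <= t * a) ->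
  sublinear (fun x => inf (E x)).
Proof.
move=> E0 Elb ED EZ; split=> [x y|t x t0].
  apply/ler_addgt0Pr => e e0; have e20 : 0 < e / 2 by rewrite divr_gt0.
  have [a xa ae] := inf_adherent e20 (conj (E0 x) (Elb x)).
  have [b yb be] := inf_adherent e20 (conj (E0 y) (Elb y)).
  have [c Ec cab] := ED _ _ _ _ xa yb.
  have := ge_inf (Elb (x + y)) Ec; lra.
move: t0; rewrite le_eqVlt => /predU1P[<-|t0].
  have [a xa] := E0 x; have [b Eb] := EZ 0 _ _ (lexx 0) xa.
  by rewrite !mul0r; apply: le_trans; apply: ge_inf Eb.
rewrite -ler_pdivrMl//; apply: lb_le_inf => // a xa.
have [b Eb ba] := EZ _ _ _ (ltW t0) xa.
by rewrite ler_pdivrMl//; apply: le_trans ba; apply: ge_inf Eb.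
Qed.

Lemma sublinearZ q t x : sublinear q -> 0 <= t -> q (t *: x) = t * q x.
Proof.
move=> sq; have [_ qZ] := sq; rewrite le_eqVlt => /predU1P[<-|t0].
  by rewrite scale0r mul0r sublinear0.
have t0' := ltW t0; apply/eqP; rewrite eq_le qZ//= -ler_pdivlMl//.
rewrite -{1}[x](scalerK (lt0r_neq0 t0)); apply: qZ.
by rewrite invr_ge0 ltW.
Qed.

(** The witness is the infimum over [t >= 0] of [q (x + t *: y) - t * q y]; the two bounds are the
    cases [t = 0] and [t = 1]. *)
Lemma sublinear_shift q y : sublinear q -> exists q',
  [/\ sublinear q', forall x, q' x <= q x
    & forall x, q' x <= q (x + y) - q y].
Proof.
move=> sq; have [qD qZ] := sq.
pose E x := [set q (x + t *: y) - t * q y | t in [set t : R | 0 <= t]].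
have Elb x : has_lbound (E x).
  exists (- q (- x)) => _ [t t0 <-].
  have := sublinear_ge x (t *: y) sq; rewrite sublinearZ//; lra.
exists (fun x => inf (E x)); split=> [|x|x].
- apply: sublinear_inf => [x|//|x x' _ _ [t t0 <-] [t' t'0 <-]|s x _ s0 [t t0 <-]].
  + by exists (q (x + 0 *: y) - 0 * q y); exists 0 => /=.
  + exists (q (x + x' + (t + t') *: y) - (t + t') * q y).
      by exists (t + t') => //; exact: addr_ge0.
    have := qD (x + t *: y) (x' + t' *: y).
    rewrite addrACA -scalerDl; lra.
  + exists (q (s *: x + (s * t) *: y) - s * t * q y).
      by exists (s * t) => //; exact: mulr_ge0.
    by rewrite -scalerA -scalerDr sublinearZ// mulrBr mulrA.
- rewrite -[q x]subr0; apply: ge_inf => //; exists 0 => //=.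
  by rewrite scale0r addr0 mul0r.
- by apply: ge_inf => //; exists 1 => //=; rewrite scale1r mul1r.
Qed.

(** By minimality every shift of [q] is [q] itself, and the second bound on the shift becomes
    [q x + q y <= q (x + y)]. *)
Lemma minimal_sublinear_scalar q : sublinear q ->
  (forall p, sublinear p -> (forall x, p x <= q x) -> p = q) -> scalar q.
Proof.
move=> sq qmin.
have qD x y : q (x + y) = q x + q y.
  have [p [sp pq pqy]] := sublinear_shift y sq; have pE := qmin _ sp pq.
  apply/eqP; rewrite eq_le sq.1/= -lerBrDr.
  by have := pqy x; rewrite pE.
have qN x : q (- x) = - q x.
  by apply/eqP; rewrite -addr_eq0 -qD addNr sublinear0.
move=> t x y; rewrite qD; congr (_ + _).
have [t0|t0] := leP 0 t; first exact: sublinearZ.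
by rewrite -[t]opprK scaleNr qN sublinearZ ?mulNr// oppr_ge0 ltW.
Qed.

(* Rather than extending partially defined functionals, Zorn's lemma is applied
   to the sublinear functionals below [q], the minimal ones being linear. *)
Theorem hahn_banach q x0 : sublinear q -> exists f : {scalar V},
  (forall x, f x <= q x) /\ f x0 = q x0.
Proof.
(* A linear [f] below this shift satisfies [f (- x0) <= q 0 - q x0 = - q x0], which pins [f x0] to
   [q x0]. *)
move=> sq; have [q0 [sq0 q0q q0x]] := sublinear_shift x0 sq.
pose P p := sublinear p /\ forall x, p x <= q0 x.
pose U := {p | P p}.
(* The order is reversed, so that a maximal element is a minimal functional. *)
have [||s t st ts|C Ctot|[p [sp pq]] pmin] :=
  @Zorn U (fun s t => `[< forall x, sval t x <= sval s x >]).
- by move=> t; apply/asboolP.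
- by move=> r s t /asboolP rs /asboolP st; apply/asboolP => x; exact: le_trans (rs x).
- case: s t st ts => [s s'] [t t'] /asboolP/= st /asboolP/= ts.
  by apply: eq_exist; apply/funext => x; apply/eqP; rewrite eq_le st ts.
(* [q0] is adjoined to the chain so that the infimum also makes sense for the empty chain. *)
- pose E x := [set s x | s in [set s | s = q0 \/ exists2 t, C t & s = sval t]].
  have Esub s : s = q0 \/ (exists2 t, C t & s = sval t) ->
      sublinear s /\ forall x, s x <= q0 x.
    by case=> [->|[[t []/= ? ?] _ ->]].
  have Ele s s' : s = q0 \/ (exists2 t, C t & s = sval t) ->
      s' = q0 \/ (exists2 t, C t & s' = sval t) ->
      (forall x, s x <= s' x) \/ (forall x, s' x <= s x).
    case=> [->|[t Ct ->]] [->|[t' Ct' ->]]; first by left.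
    - by right; case: (svalP t').
    - by left; case: (svalP t).
    - by have [/asboolP|/asboolP] := Ctot _ _ Ct Ct'; [right|left].
  have Elb x : has_lbound (E x).
    exists (- q0 (- x)) => _ [s /Esub[ss sq0'] <-].
    have := sublinear_ge x 0 ss; rewrite addr0 sublinear0//.
    have := sq0' (- x); lra.
  have sE : sublinear (fun x => inf (E x)).
    apply: sublinear_inf => [x|//|x y _ _ [s Cs <-] [s' Cs' <-]|t x _ t0 [s Cs <-]].
    + by exists (q0 x), q0 => //; left.
    + have [ss|ss] := Ele _ _ Cs Cs'.
      * exists (s (x + y)); first by exists s.
        have := (Esub _ Cs).1.1 x y; have := ss y; lra.
      * exists (s' (x + y)); first by exists s'.
        have := (Esub _ Cs').1.1 x y; have := ss x; lra.
    + exists (s (t *: x)); first by exists s.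
      exact: (Esub _ Cs).1.2.
  have Eq0 x : inf (E x) <= q0 x.
    by apply: ge_inf => //; exists q0 => //; left.
  exists (exist P _ (conj sE Eq0)) => t Ct; apply/asboolP => x /=.
  by apply: ge_inf => //; exists (sval t) => //; right; exists t.
- have lp : scalar p.
    apply: minimal_sublinear_scalar => // p' sp' p'p.
    have p'q x : p' x <= q0 x by exact: le_trans (p'p x) (pq x).
    have : exist P _ (conj sp' p'q) = exist P _ (conj sp pq).
      by apply: pmin; apply/asboolP.
    by case.
  pose lm := GRing.isLinear.Build R V R *%R p lp.
  pose f : {scalar V} := HB.pack p lm.
  exists f; split=> [x|]; first exact: le_trans (pq x) (q0q x).
  apply/eqP; rewrite eq_le (le_trans (pq _) (q0q _))/=.
  have := le_trans (pq (- x0)) (q0x (- x0)).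
  rewrite addNr sublinear0// sub0r.
  by rewrite -[p (- x0)]/(f (- x0)) linearN lerN2.
Qed.

End hahn_banach.

(** * Unique ergodicity in one fibre *)

Section real_restriction.
Context (R : realType) (V : lmodType R[i]).

(** A separate name lets the real scalar structure coexist with the complex one on [V]. *)
Definition real_lmod : Type := V.
HB.instance Definition _ := GRing.Zmodule.on real_lmod.

Definition real_scale (a : R) (x : real_lmod) : real_lmod := a%:C *: (x : V).

Let real_scaleA a b x : real_scale a (real_scale b x) = real_scale (a * b) x.
Proof. by rewrite /real_scale scalerA -rmorphM. Qed.
Let real_scale1 : left_id 1 real_scale.
Proof. exact: scale1r. Qed.
Let real_scaleDr : right_distributive real_scale +%R.
Proof. by move=> a x y; exact: scalerDr. Qed.
Let real_scaleDl x : {morph real_scale^~ x : a b / a + b}.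
Proof. by move=> a b; rewrite /real_scale rmorphD scalerDl. Qed.

HB.instance Definition _ := GRing.Zmodule_isLmodule.Build R real_lmod
  real_scaleA real_scale1 real_scaleDr real_scaleDl.

(** For real-linear [f], the only complex-linear functional with real part [f]. *)
Definition complexify (f : real_lmod -> R) (x : V) : R[i] :=
  Complex (f x) (- f ('i *: x)).

Lemma complexify_scalar (f : {scalar real_lmod}) : scalar (complexify f).
Proof.
have fD (x y : V) : f (x + y) = f x + f y by exact: linearD.
have fZ (a : R) (x : V) : f (a%:C *: x) = a * f x by exact: linearZ.
have fN (x : V) : f (- x) = - f x by exact: linearN.
case=> a b x y; rewrite /complexify.
have -> : (a +i* b)%C *: x = a%:C *: x + b%:C *: ('i *: x).
  by rewrite scalerA -scalerDl; congr (_ *: _); simpc.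
have -> : 'i *: (a%:C *: x + b%:C *: ('i *: x) + y) =
  a%:C *: ('i *: x) + b%:C *: ('i *: ('i *: x)) + 'i *: y by lmodring.
rewrite [in 'i *: ('i *: x)]scalerA -expr2 sqr_i scaleN1r.
by rewrite !fD !fZ fN; congr Complex; ring.
Qed.

End real_restriction.

Section unique_ergodicity.
Context (R : realType) (A : cstarAlgType R) (e : A).
Hypotheses (he : is_unit e) (e_neq0 : e != 0).
Context (S : {linear A -> A}) (hS : is_markov S).
Implicit Types (x y h : A) (c : R).

Local Notation npos := (npos e).

Lemma nrm_unit : nrm e = 1.
Proof.
have := nrm_cstar e; rewrite (star1 he) (cmul1x he) => ee.
have : nrm e != 0.
  by apply: contra_neq e_neq0 => e0; apply: nrm0_eq0; rewrite e0.
by move=> /mulfI; apply; rewrite mulr1 -expr2.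
Qed.

Lemma npos_unit_ge0 c : npos (c%:C *: e) -> 0 <= c.
Proof.
move=> [_ [a a0]]; rewrite -scalerBl -rmorphB/= nrmZr nrm_unit mulr1.
by rewrite ler_norml => /andP[]; lra.
Qed.

Lemma npos0 : npos 0.
Proof. by rewrite -(cmul0x (0 : A)); apply: (npos_sq he); rewrite star0. Qed.

Lemma markov_npos x : npos x -> npos (S x).
Proof. by move=> /(npos_cstar_pos he) /hS.1 /(npos_cstar_pos he). Qed.

Lemma markov_unit : S e = e. Proof. exact: hS.2. Qed.

(** The image of the positive element [nrm h - h] is positive, in particular self-adjoint, and
    [S e = e] isolates [S h] in it. *)
Lemma markov_sa h : star h = h -> star (S h) = S h.
Proof.
move=> sh; have /markov_npos[] : npos ((nrm h)%:C *: e - h).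
  exact: npos_subr.
rewrite linearB linearZ/= markov_unit starB (starZr (nrm h)) (star1 he).
by move=> /addrI/oppr_inj.
Qed.

Definition re_part x : A := (2^-1)%:C *: (x + star x).

Lemma re_part_lin (a : R) x y :
  re_part (a%:C *: x + y) = a%:C *: re_part x + re_part y.
Proof. by rewrite /re_part starD starZr; lmodring. Qed.

Lemma re_partD x y : re_part (x + y) = re_part x + re_part y.
Proof. by have := re_part_lin 1 x y; rewrite !scale1r. Qed.

Lemma re_part0 : re_part 0 = 0.
Proof. by rewrite /re_part star0 addr0 scaler0. Qed.

Lemma re_partZ (a : R) x : re_part (a%:C *: x) = a%:C *: re_part x.
Proof. by have := re_part_lin a x 0; rewrite re_part0 !addr0. Qed.

Lemma re_partN x : re_part (- x) = - re_part x.
Proof. by rewrite -scaleN1r -(rmorphN1 (real_complex R)) re_partZ rmorphN1 scaleN1r. Qed.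

Lemma half_double x : (2^-1)%:C *: (x + x) = x.
Proof.
have -> : (2^-1)%:C *: (x + x) = (2^-1 * 2)%:C *: x by lmodring.
by rewrite mulVf// scale1r.
Qed.

Lemma re_part_id h : star h = h -> re_part h = h.
Proof. by move=> sh; rewrite /re_part sh half_double. Qed.

Lemma star_re_part x : star (re_part x) = re_part x.
Proof. by rewrite /re_part starZr starD starK addrC. Qed.

Lemma re_part_i h : star h = h -> re_part ('i *: h) = 0.
Proof. by move=> sh; rewrite /re_part starZi sh; lmodring. Qed.

Lemma re_im x : x = re_part x + 'i *: re_part (- ('i *: x)).
Proof.
rewrite /re_part starN starZi opprK.
have -> : (2^-1)%:C *: (x + star x) +
    'i *: ((2^-1)%:C *: (- ('i *: x) + 'i *: star x)) =
  (2^-1)%:C *: (x + star x + ('i *: ('i *: star x) - 'i *: ('i *: x))) by lmodring.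
by rewrite !scalerA mulcii !scaleN1r opprK addrA addrK half_double.
Qed.

Lemma nrm_re_part x : nrm (re_part x) <= nrm x.
Proof.
rewrite nrmZr ger0_norm ?invr_ge0// ler_pdivrMl//.
by apply: le_trans (nrmD _ _) _; rewrite nrm_star mulr_natl mulr2n.
Qed.

Lemma markov_star x : S (star x) = star (S x).
Proof.
have [a [b [sa sb ->]]] : exists a b, [/\ star a = a, star b = b & x = a + 'i *: b].
  exists (re_part x), (re_part (- ('i *: x))).
  by split; [exact: star_re_part|exact: star_re_part|exact: re_im].
rewrite starD starZi sa sb linearB linearD !linearZ/= starD starZi.
by rewrite !markov_sa// scalerN.
Qed.

Lemma markov_re_part x : S (re_part x) = re_part (S x).
Proof. by rewrite /re_part linearZ/= linearD/= markov_star. Qed.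

(** * Birkhoff averages and their asymptotic upper bounds *)

Definition birkhoff n x : A :=
  (n.+1%:R^-1)%:C *: \sum_(k < n.+1) iter k S x.

Lemma iter_markov_linear k : linear (iter k S).
Proof. by elim: k => // k IH a x y /=; rewrite IH linearP. Qed.

Lemma birkhoff_linear n : linear (birkhoff n).
Proof.
move=> a x y; rewrite /birkhoff.
under eq_bigr do rewrite iter_markov_linear.
by rewrite big_split/= -scaler_sumr; lmodring.
Qed.

HB.instance Definition _ n :=
  GRing.isLinear.Build R[i] A A *:%R (birkhoff n) (birkhoff_linear n).

Lemma birkhoffZ n (a : R[i]) x : birkhoff n (a *: x) = a *: birkhoff n x.
Proof. exact: linearZ. Qed.

Lemma birkhoffD n x y : birkhoff n (x + y) = birkhoff n x + birkhoff n y.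
Proof. exact: linearD. Qed.

Lemma birkhoffN n x : birkhoff n (- x) = - birkhoff n x.
Proof. exact: linearN. Qed.

Lemma birkhoff_npos n x : npos x -> npos (birkhoff n x).
Proof.
move=> px; rewrite /birkhoff; apply: nposZ; first by rewrite invr_ge0.
apply: (big_ind npos) => [|y z|k _]; [exact: npos0|exact: nposD|].
by elim: (nat_of_ord k) => //= m; exact: markov_npos.
Qed.

Lemma birkhoff_unit n : birkhoff n e = e.
Proof.
rewrite /birkhoff (eq_bigr (fun=> e)) => [|k _]; last first.
  by elim: (nat_of_ord k) => //= m ->; exact: markov_unit.
rewrite sumr_const card_ord -[e *+ _]scaler_nat scalerA.
by rewrite -(rmorph_nat (real_complex R)) -rmorphM/= mulVf ?scale1r// pnatr_eq0.
Qed.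

Lemma birkhoff_le n c h :
  npos (c%:C *: e - h) -> npos (c%:C *: e - birkhoff n h).
Proof. by move/(birkhoff_npos n); rewrite birkhoffD birkhoffN birkhoffZ birkhoff_unit. Qed.

(** [S] preserves the order bounds [- nrm h <= h <= nrm h], and [nrm_le_npos] turns them back into a
    norm bound. *)
Lemma markov_iter_nrm k h : star h = h ->
  star (iter k S h) = iter k S h /\ nrm (iter k S h) <= nrm h.
Proof.
move=> sh; elim: k => [//|k [sk nk]] /=; split; first exact: markov_sa.
apply: (nrm_le_npos he); first exact: nrm_ge0.
- have /markov_npos := npos_subr he sk nk.
  by rewrite linearB linearZ/= markov_unit.
- have /markov_npos : npos ((nrm h)%:C *: e - (- iter k S h)).
    by apply: (npos_subr he); rewrite ?nrmN// starN sk.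
  by rewrite opprK linearD linearZ/= markov_unit.
Qed.

Lemma birkhoff_coboundary n h :
  birkhoff n (h - S h) = (n.+1%:R^-1)%:C *: (h - iter n.+1 S h).
Proof.
rewrite /birkhoff; congr (_ *: _).
under eq_bigr => k _.
  rewrite (_ : iter k S (h - S h) = iter k S h - iter k.+1 S h); last first.
    by rewrite iterSr; elim: (nat_of_ord k) => //= m ->; rewrite linearB.
  over.
rewrite /= -(big_mkord xpredT (fun k => iter k S h - iter k.+1 S h)).
rewrite (@telescope_sumr_eq _ _ _ (fun k => - iter k S h))//.
  by rewrite opprK addrC.
by move=> k _; rewrite opprK addrC.
Qed.

(** Taking [re_part] defines the bounds on all of [A], so that the Hahn-Banach theorem applies to
    the whole underlying real space. *)
Definition mean_bounds x : set R :=
  [set c | \forall n \near \oo, npos (c%:C *: e - birkhoff n (re_part x))].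

(* The limsup of the suprema of the spectra of the Birkhoff averages of
   [re_part x]. *)
Definition upper_mean (x : real_lmod A) : R := inf (mean_bounds x).

Lemma mean_bounds_nrm x : mean_bounds x (nrm x).
Proof.
apply: nearW => n; apply/birkhoff_le/(npos_subr he); first exact: star_re_part.
exact: nrm_re_part.
Qed.

Lemma mean_bounds_ge x c : mean_bounds x c -> - nrm x <= c.
Proof.
move=> [n _ /(_ n (leqnn n))/= xc]; rewrite -subr_ge0 opprK.
have : npos ((nrm x)%:C *: e - birkhoff n (- re_part x)).
  apply/birkhoff_le/(npos_subr he); first by rewrite starN star_re_part.
  by rewrite nrmN nrm_re_part.
rewrite birkhoffN opprK => /(nposD xc).
rewrite addrACA addNr addr0 -scalerDl -rmorphD/=; exact: npos_unit_ge0.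
Qed.

Lemma has_lbound_mean_bounds x : has_lbound (mean_bounds x).
Proof. by exists (- nrm x) => c; exact: mean_bounds_ge. Qed.

Lemma upper_mean_le x c : mean_bounds x c -> upper_mean x <= c.
Proof. by apply: ge_inf; exact: has_lbound_mean_bounds. Qed.

Lemma upper_mean_sublinear : sublinear upper_mean.
Proof.
apply: sublinear_inf => [x|x|x y a b xa yb|t x a t0 xa].
- by exists (nrm (x : A)); exact: mean_bounds_nrm.
- exact: has_lbound_mean_bounds.
- exists (a + b) => //; apply: filterS2 xa yb => n xa yb.
  have -> : (a + b)%:C *: e - birkhoff n (re_part (x + y)) =
      (a%:C *: e - birkhoff n (re_part x)) + (b%:C *: e - birkhoff n (re_part y)).
    by rewrite re_partD birkhoffD; lmodring.
  exact: nposD.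
- exists (t * a) => //; apply: filterS xa => n xa.
  have -> : (t * a)%:C *: e - birkhoff n (re_part (t *: x)) =
      t%:C *: (a%:C *: e - birkhoff n (re_part x)).
    by rewrite [t *: x]/(t%:C *: (x : A)) re_partZ birkhoffZ; lmodring.
  exact: nposZ.
Qed.

(** The averages telescope to norm at most [2 nrm h / (n + 1)], where [h = re_part x]. This is what
    makes dominated functionals invariant. *)
Lemma upper_mean_coboundary x : upper_mean (x - S x) <= 0.
Proof.
apply/ler_addgt0Pr => c c0; rewrite add0r; apply: upper_mean_le.
near=> n; rewrite re_partD re_partN -markov_re_part birkhoff_coboundary.
set h := re_part x; have sh : star h = h by exact: star_re_part.
have [sk nk] := markov_iter_nrm n.+1 sh.
apply: (npos_subr he); first by rewrite starZr starB sk sh.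
rewrite nrmZr ger0_norm ?invr_ge0// ler_pdivrMl//.
apply: le_trans (nrmB _ _) _; apply: le_trans (lerD (lexx _) nk) _.
rewrite -ler_pdivrMr//; apply: (@le_trans _ _ n%:R); last by rewrite ler_nat.
by near: n; exact: nbhs_infty_ger.
Unshelve. all: by end_near. Qed.

Lemma upper_mean_npos x : npos x -> upper_mean (- x) <= 0.
Proof.
move=> px; apply: upper_mean_le; apply: nearW => n.
rewrite scale0r sub0r re_partN birkhoffN opprK re_part_id ?px.1//.
exact: birkhoff_npos.
Qed.

(** Applied to [h] and [- h], this makes a dominated functional vanish at ['i *: h], so that its
    complexification is real at [h]. *)
Lemma upper_mean_i h : star h = h -> upper_mean ('i *: h) <= 0.
Proof.
move=> sh; apply: upper_mean_le; apply: nearW => n.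
by rewrite scale0r sub0r re_part_i// linear0 oppr0; exact: npos0.
Qed.

(* A linear functional dominated by [upper_mean] is the real part of an
   invariant state. *)
Lemma invariant_state_upper_mean x0 : exists psi : {scalar A},
  [/\ is_state psi, forall x, psi (S x) = psi x,
      forall h, star h = h -> complex.Im (psi h) = 0
    & complex.Re (psi x0) = upper_mean x0].
Proof.
have [f [fq fx0]] := @hahn_banach R (real_lmod A) upper_mean x0 upper_mean_sublinear.
have fN x : f (- x : A) = - f x by exact: linearN.
have fD x y : f (x + y : A) = f x + f y by exact: linearD.
pose lm := GRing.isLinear.Build R[i] A R[i] *%R (complexify f) (complexify_scalar f).
pose psi : {scalar A} := HB.pack (complexify f) lm.
have psiE x : psi x = Complex (f x) (- f ('i *: x)) by [].
(* The coboundary bound at [x] and at [- x] gives the two inequalities. *)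
have fS x : f (S x) = f x.
  have h y : f y <= f (S y).
    by rewrite -subr_le0 -fN -fD; apply: le_trans (fq _) (upper_mean_coboundary _).
  by apply/eqP; rewrite eq_le h andbT -lerN2 -!fN -linearN h.
have fi h : star h = h -> f ('i *: h) = 0.
  move=> sh; apply/eqP; rewrite eq_le (le_trans (fq _) (upper_mean_i sh))/=.
  rewrite -oppr_le0 -fN -scalerN; apply: le_trans (fq _) (upper_mean_i _).
  by rewrite starN sh.
have f1 : f e = 1.
  apply/eqP; rewrite eq_le; apply/andP; split.
    by apply: le_trans (fq _) _; rewrite -nrm_unit; exact/upper_mean_le/mean_bounds_nrm.
  rewrite -lerN2 -fN; apply: le_trans (fq _) (upper_mean_le _); apply: nearW => n.
  rewrite re_partN re_part_id ?(star1 he)// birkhoffN birkhoff_unit opprK.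
  by rewrite rmorphN1 scaleN1r addNr; exact: npos0.
have psi_le x : `|x| <= 1 -> `|psi x| <= 1.
  move=> x1; have [->|px0] := eqVneq (psi x) 0; first by rewrite normr0 ler01.
  (* The phase [t] rotates [psi x] onto the positive axis, where domination of the real part by the
     norm suffices. *)
  pose t := `|psi x| / psi x.
  have nt : `|t| = 1 by rewrite /t normrM normfV normr_id divff// normr_eq0.
  have ptx : psi (t *: x) = `|psi x| by rewrite linearZ/= /t divfK.
  have : complex.Re (psi (t *: x)) <= 1.
    apply: le_trans (fq _) _; apply: le_trans (upper_mean_le (mean_bounds_nrm _)) _.
    by rewrite nrm_le normrZ nt mul1r.
  by rewrite ptx -lecR RRe_real// normr_real.
exists psi; split.
- split=> [x /(npos_cstar_pos he) px|].
    rewrite psiE fi ?px.1// oppr0 ler0c -oppr_le0 -fN.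
    exact: le_trans (fq _) (upper_mean_npos px).
  split=> [_ [x /psi_le ? <-]//|b /(_ 1)]; apply; exists e.
    by rewrite /= nrmE nrm_unit.
  by rewrite psiE fi ?(star1 he)// f1 oppr0 normr1.
- by move=> x; rewrite !psiE -linearZ/= !fS.
- by move=> h sh; rewrite psiE/= fi// oppr0.
- exact: fx0.
Qed.

Theorem uniquely_ergodic_cvg (phi : {scalar A}) x : uniquely_ergodic phi S ->
  birkhoff ^~ x @ \oo --> phi x *: e.
Proof.
move=> ue.
(* Each value of [upper_mean] is the real part of the value of some invariant state, which can only
   be [phi]. *)
have meanE y : upper_mean y = complex.Re (phi y).
  have [psi [spsi Spsi _ <-]] := invariant_state_upper_mean y.
  by rewrite (ue _ spsi Spsi).
have phi_im h : star h = h -> complex.Im (phi h) = 0.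
  move=> sh; have [psi [spsi Spsi /(_ _ sh) + _]] := invariant_state_upper_mean h.
  by rewrite (ue _ spsi Spsi).
have bound h c : star h = h -> complex.Re (phi h) < c ->
    \forall n \near \oo, npos (c%:C *: e - birkhoff n h).
  move=> sh; rewrite -meanE -subr_gt0 => c0.
  have hi : has_inf (mean_bounds h).
    by split; [exists (nrm h); exact: mean_bounds_nrm|exact: has_lbound_mean_bounds].
  have [b hb] := inf_adherent c0 hi.
  rewrite -/(upper_mean h) addrC subrK => /ltW bc.
  (* Adding the positive multiple [(c - b) *: e] of the unit raises the bound [b] to [c]. *)
  apply: filterS hb => n; rewrite re_part_id// => /(nposD (y := (c - b)%:C *: e)).
  move=> /(_ (nposZ _ (npos1 he))); rewrite subr_ge0 => /(_ bc).
  by rewrite (_ : _ + _ = c%:C *: e - birkhoff n h)//; lmodring.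
have sa_cvg h : star h = h -> birkhoff ^~ h @ \oo --> phi h *: e.
  move=> sh; apply/cvg_nrmP => c c0; have c20 : 0 < c / 2 by rewrite divr_gt0.
  pose a := complex.Re (phi h).
  have phE : phi h = a%:C by rewrite [LHS]complexE phi_im// mulr0 addr0.
  have snh : star (- h) = - h by rewrite starN sh.
  have /(bound _ _ sh) : complex.Re (phi h) < a + c / 2 by rewrite ltrDl.
  have /(bound _ _ snh) : complex.Re (phi (- h)) < - a + c / 2.
    by rewrite linearN raddfN ltrDl.
  apply: filterS2 => n; rewrite birkhoffN => lo up.
  apply: (@le_lt_trans _ _ (c / 2)); last by rewrite ltr_pdivrMr// ltr_pMr// ltr1n.
  apply: (nrm_le_npos he); rewrite ?ltW// phE.
  - rewrite (_ : _ - _ = (- a + c / 2)%:C *: e - - birkhoff n h)//; lmodring.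
  - rewrite (_ : _ + _ = (a + c / 2)%:C *: e - birkhoff n h)//; lmodring.
have -> : phi x *: e = phi (re_part x) *: e +
    'i *: (phi (re_part (- ('i *: x))) *: e).
  rewrite {1}(re_im x) linearD [phi ('i *: _)]linearZ/=; lmodring.
have -> : birkhoff ^~ x = fun n => birkhoff n (re_part x) +
    'i *: birkhoff n (re_part (- ('i *: x))).
  by apply/funext => n; rewrite -birkhoffZ -birkhoffD -re_im.
by apply: cvgD; [|apply: cvgZ; first exact: cvg_cst];
  apply: sa_cvg; exact: star_re_part.
Qed.

End unique_ergodicity.

(** * Order convergence in [L0] *)

Section representatives.
Context d (T : measurableType d) (R : realType) (lambda : complete_measure T R).

Section lift.
Variables (Y Z W : T -> Type).
Variables (P : set (psection Y)) (Q : set (psection Z)) (U : set (psection W)).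

(** With [in_cls_lift2], this allows classes to be computed on everywhere defined representatives,
    away from partial sections. *)
Lemma in_cls_lift1 op H (x : aeclass lambda P) (f : forall w, Y w) :
  in_cls (ptotal f) x ->
  in_cls (ptotal (fun w => op w (f w))) (@lift1 _ _ _ lambda Y Z P Q op H x).
Proof.
move=> xf; have := @in_cls_repr _ T R lambda Z Q (AESection (H _ (aevalP (repr x)))).
by apply: filterS2 xf => w /= xf ->; rewrite /pmap1 xf.
Qed.

Lemma in_cls_lift2 op H (x : aeclass lambda P) (y : aeclass lambda Q)
    (f : forall w, Y w) (g : forall w, Z w) :
  in_cls (ptotal f) x -> in_cls (ptotal g) y ->
  in_cls (ptotal (fun w => op w (f w) (g w)))
    (@lift2 _ _ _ lambda Y Z W P Q U op H x y).
Proof.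
move=> xf yg; have := @in_cls_repr _ T R lambda W U
  (AESection (H _ _ (aevalP (repr x)) (aevalP (repr y)))).
by apply: filterS3 xf yg => w /= xf yg ->; rewrite /pmap2 xf yg.
Qed.

End lift.

Lemma in_cls_eq (Y : T -> Type) (P : set (psection Y)) (x : aeclass lambda P)
    (f g : forall w, Y w) :
  (forall w, f w = g w) -> in_cls (ptotal f) x -> in_cls (ptotal g) x.
Proof.
by move=> fg; apply: filterS => w ->; rewrite /ptotal fg.
Qed.

Lemma L0_leP (x y : L0 lambda) (f g : T -> R[i]) :
  in_cls (ptotal f) x -> in_cls (ptotal g) y ->
  x <= y <-> \forall w \ae lambda, f w <= g w.
Proof.
move=> xf yg; split=> [/asboolP|] fg.
  apply: filterS3 xf yg fg => w -> -> [a [b [[<-] [<-] //]]].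
apply/asboolP; apply: filterS3 xf yg fg => w -> -> fg.
by exists (f w), (g w).
Qed.

Lemma in_cls_cst (c : R[i]) : in_cls (ptotal (fun=> c)) (L0_cst lambda c).
Proof. exact: in_cls_repr. Qed.

Lemma in_cls_measurable (x : L0 lambda) (h : T -> R) :
  in_cls (ptotal (fun w => (h w)%:C)) x -> measurable_fun setT h.
Proof.
move=> xh; have /mfunctionP[g [mRe _ xg]] := aevalP (repr x).
apply: (ae_measurable_real (lambda := lambda)) mRe.
by apply: filterS2 xg xh => w -> [->].
Qed.

Lemma in_cls_exists (x : L0 lambda) :
  exists f, in_cls (ptotal f) x.
Proof.
have /mfunctionP[g [_ _ xg]] := aevalP (repr x).
by exists g.
Qed.

Lemma o_cvg_ae (f : nat -> L0 lambda) (h : nat -> T -> R) :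
  (forall n, in_cls (ptotal (fun w => (h n w)%:C)) (f n)) ->
  (forall n w, 0 <= h n w) ->
  (\forall w \ae lambda, h ^~ w @ \oo --> (0 : R)) -> o_cvg f 0.
Proof.
move=> fh h0 [N [mN N0 hN]].
have mh n : measurable_fun setT (h n) by exact: in_cls_measurable (fh n).
(* Cutting off the null set [N] makes convergence hold at every point, so all tail suprema are
   finite and form measurable functions. *)
pose k n w := h n w * \1_(~` N) w.
have kcvg w : k ^~ w @ \oo --> (0 : R).
  have [Nw|Nw] := pselect (N w).
    rewrite (_ : k ^~ w = fun=> 0); first exact: cvg_cst.
    by apply/funext => n; rewrite /k indicE memNset ?mulr0//; exact.
  rewrite (_ : k ^~ w = h ^~ w); first by apply: contra_notP Nw => /hN.
  by apply/funext => n; rewrite /k indicE mem_set ?mulr1.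
have hk : \forall w \ae lambda, forall n, h n w = k n w.
  exists N; split=> // w /= hw; apply: contrapT => Nw; apply: hw => n.
  by rewrite /k indicE mem_set ?mulr1.
have kub w : has_ubound (range (k ^~ w)).
  have /cvg_seq_bounded/bounded_fun_has_ubound// : cvgn (k ^~ w).
  by apply/cvg_ex; exists 0; exact: kcvg.
have mG n : measurable_fun setT (fun w => sups (k ^~ w) n).
  apply: measurable_fun_sups => // m; apply: measurable_funM => //.
  by apply: measurable_indic; exact: measurableC.
have k0 n w : 0 <= k n w by rewrite mulr_ge0// indicE.
have kG n w : k n w <= sups (k ^~ w) n.
  apply: ub_le_sup; first exact: has_ubound_sdrop.
  by exists n => /=.
have mGC n : mfunction lambda (ptotal (fun w => (sups (k ^~ w) n)%:C)).
  by apply: mfunction_ptotal => /=; [exact: mG|exact: measurable_cst].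
pose G n : L0 lambda := cls lambda (AESection (mGC n)).
have GE n : in_cls (ptotal (fun w => (sups (k ^~ w) n)%:C)) (G n).
  exact: in_cls_repr.
exists G; split.
- move=> n; apply/(L0_leP (GE _) (GE _)); apply: aeW => w; rewrite lecR.
  exact: nonincreasing_sups (leqnSn n).
- split=> [_ [n _ <-]|y yG].
    apply/(L0_leP (in_cls_cst 0) (GE _)); apply: aeW => w.
    by rewrite ler0c (le_trans (k0 n w)).
  have [g yg] := in_cls_exists y.
  apply/(L0_leP yg (in_cls_cst 0)).
  have : \forall w \ae lambda, forall n, g w <= (sups (k ^~ w) n)%:C.
    apply: ae_foralln => n; apply/(L0_leP yg (GE n)); apply: yG.
    by exists n.
  apply: filterS => w gG; rewrite lecE/=.
  (* The order of [R[i]] forces equal imaginary parts, so a single inequality already shows that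
     [g w] is real. *)
  have /[!lecE]/= /andP[-> _] := gG 0%N.
  apply: (cvgr_to_ge (cvg_sups (kcvg w))); apply: nearW => n.
  by have /[!lecE]/= /andP[] := gG n.
- move=> n; rewrite subr0; apply/(L0_leP (in_cls_lift1 _ (fh n)) (GE _)).
  apply: filterS hk => w hk; rewrite ger0_norm ?ler0c// lecR hk; exact: kG.
Qed.

End representatives.

(** * Sections of the bundle and the passage from the fibres to [L0] *)

Section bundle.
Context (d : measure_display) (T : measurableType d) (R : realType).
Context (lambda : complete_measure T R) (X : cstar_bundle lambda).

Lemma in_cls_section_exists (x : L0X X) :
  exists f : forall w, X w, in_cls (ptotal f) x.
Proof.
exists (fun w => odflt 0 (aeval (repr x) w)).
apply: filterS (msection_defined (aevalP (repr x))) => w.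
by rewrite /pdom /ptotal/=; case: (aeval (repr x) w).
Qed.

Lemma dense_nrm (A : normedModType R[i]) (B : set A) (y : A) (c : R) :
  dense B -> 0 < c -> exists2 x, B x & nrm (y - x) < c.
Proof.
move=> dB c0; have c0' : (0 : R[i]) < c%:C by rewrite ltcR.
have [|x [yx Bx]] := dB _ _ (ball_open y c%:C).
  by exists y; exact: ballxx.
by exists x => //; move: yx; rewrite -ball_normE/= nrmE ltcR.
Qed.

(** By multiplicativity of [l], [l e w] acts as a unit on the values of [l] at [w], which are dense.
    Its norm is [p 1 w = 1], so approximating [y] within [c] costs an error of at most [2 c]. *)
Lemma lifting_unit (p : L0 lambda -> T -> R[i]) (l : L0X X -> forall w, X w)
    (e : L0X X) w :
  is_lifting p -> is_vector_lifting p l -> L0X_is_unit e -> L0X_norm e = 1 ->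
  LinfX e /\ is_unit (l e w).
Proof.
move=> hp hl he he1.
have Le : LinfX e.
  exists 1; first exact: ltr01.
  have abs1 : in_cls (ptotal (fun=> `|1 : R[i]|)) (L0_abs (1 : L0 lambda)).
    exact/in_cls_lift1/in_cls_cst.
  rewrite he1; apply/(L0_leP abs1 (in_cls_cst lambda _)).
  by apply: aeW => ?; rewrite normr1.
split=> // y.
have ne : nrm (l e w) = 1.
  by apply: complexI; rewrite -nrmE (vlifting_norm hl)// he1 (lifting1 hp).
have dense_l : dense [set l x w | x in @LinfX _ _ _ _ X].
  by case: hl => ? ? ? ? ? ? ?; apply.
have close (z : X w) : (forall c, 0 < c -> nrm z <= 2 * c) -> z = 0.
  move=> zc; apply: nrm0_eq0; apply/ler_addgt0Pr => c c0.
  have := zc (c / 2); rewrite divr_gt0// => /(_ isT); lra.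
have near_l c : 0 < c -> exists2 x, LinfX x & nrm (y - l x w) < c.
  by move=> c0; have [_ [x Lx <-] yx] := dense_nrm y dense_l c0; exists x.
split; apply/eqP; rewrite -subr_eq0; apply/eqP/close => c /near_l[x Lx /ltW xc].
- have -> : cmul (l e w) y - y = cmul (l e w) (y - l x w) - (y - l x w).
    by rewrite cmulBr -(vliftingM hl)// (he x).1 opprB addrA subrK.
  apply: le_trans (nrmB _ _) _; apply: le_trans (lerD (nrmM _ _) (lexx _)) _.
  rewrite ne; lra.
- have -> : cmul y (l e w) - y = cmul (y - l x w) (l e w) - (y - l x w).
    by rewrite cmulBl -(vliftingM hl)// (he x).2 opprB addrA subrK.
  apply: le_trans (nrmB _ _) _; apply: le_trans (lerD (nrmM _ _) (lexx _)) _.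
  rewrite ne; lra.
Qed.

Lemma in_cls_birkhoff_sum (D : dynsys_bundle X) (S : {linear L0X X -> L0X X})
    (x : L0X X) (f : forall w, X w) n :
  S =1 hat_markov D -> in_cls (ptotal f) x ->
  in_cls (ptotal (fun w => \sum_(k < n) iter k (bmarkov D w) (f w)))
    (\sum_(k < n) iter k S x).
Proof.
move=> hS xf; elim: n => [|n IH].
  rewrite big_ord0; apply: (in_cls_eq (f := fun w => 0 : X w)).
    by move=> w; rewrite big_ord0.
  exact: in_cls_repr.
rewrite big_ord_recr/=; apply: (in_cls_eq (f := fun w =>
    \sum_(k < n) iter k (bmarkov D w) (f w) + iter n (bmarkov D w) (f w))).
  by move=> w; rewrite big_ord_recr.
apply: in_cls_lift2 => //.
by elim: n {IH} => //= k IH; rewrite hS; apply: in_cls_lift1.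
Qed.

End bundle.

Theorem theorem5p7 (d : measure_display) (T : measurableType d) (R : realType)
    (lambda : complete_measure T R) (X : cstar_bundle lambda)
    (p : L0 lambda -> T -> R[i]) (hp : is_lifting p)
    (l : L0X X -> forall w : T, X w) (hl : is_vector_lifting p l)
    (e : L0X X) (he : L0X_is_unit e) (he1 : L0X_norm e = 1)
    (D : dynsys_bundle X)
    (phi : {scalar L0X X}) (S : {linear L0X X -> L0X X})
    (hsys : L0X_is_dynsys e phi S)
    (hphi : phi =1 hat_state D) (hS : S =1 hat_markov D)
    (hue : \forall w \ae lambda, uniquely_ergodic (bstate D w) (bmarkov D w)) :
  L0X_uniquely_ergodic e phi S.
Proof.
move=> x; have [f xf] := in_cls_section_exists x.
(* The boundedness of [e] does not involve a fibre; [point] is an arbitrary choice. *)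
have Le := (lifting_unit point hp hl he he1).1.
have eE w := (lifting_unit w hp hl he he1).2.
pose h n w := nrm (birkhoff (bmarkov D w) n (f w) - bstate D w (f w) *: l e w).
apply: (o_cvg_ae (h := h)) => [n|n w|]; last first.
- apply: filterS hue => w ue.
  (* A zero unit would make the whole fibre zero. *)
  have e0 : l e w != 0.
    have [y] := fiber_neq0 X w; apply: contra_neq => le0.
    by rewrite -((eE w) y).1 le0 cmul0x.
  have [_ _ mS _] := bdynsys D w.
  have /cvg_nrmP cv := uniquely_ergodic_cvg (eE w) e0 mS (x := f w) ue.
  apply/cvgrPdist_lt => c /cv; apply: filterS => n.
  by rewrite sub0r normrN ger0_norm ?nrm_ge0// nrm_distC.
- exact: nrm_ge0.
(* The real-valued [h] is rewritten with the complex norm and a complex scalar, to match the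
   operations of [L0X] one by one. *)
apply: (in_cls_eq (f := fun w => `|(n.+1%:R^-1 : R[i]) *:
    (\sum_(k < n.+1) iter k (bmarkov D w) (f w)) - bstate D w (f w) *: l e w|)).
  by move=> w; rewrite nrmE /h /birkhoff fmorphV rmorph_nat.
apply: in_cls_lift1; apply: in_cls_lift2.
  apply: in_cls_lift2; first exact: in_cls_cst.
  exact: in_cls_birkhoff_sum.
apply: in_cls_lift1; apply: in_cls_lift2; last exact: (vlifting_in_cls hl).
by rewrite hphi; apply: in_cls_lift1.
Qed.
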